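(* The complex invariants of the reflection group $G_{34}$ form a polynomial algebra $$\mathbb C[x_1,\ldots,x_6]^{G_{34}}\approx\mathbb C[f_6,f_{12},f_{18},f_{24},f_{30},f_{42}]$$ with generators given (for $k=1,2,3,4,5,7$) by $$f_{6k}=\bigl(1+(-1)^k27^{k-1}\cdot5\bigr)m_{(6k)}+\sum_{s=1}^k\binom{6k}{3s}\bigl(1+(-1)^{k+s}27^{k-1}\bigr)m_{(6k-3s,3s)}+\sum_{\mathbf e}(\mathbf e)\,m_{\mathbf e},$$ where $\mathbf e$ ranges over all partitions $\mathbf e=(e_1,\ldots,e_r)$ of $6k$ with $3\le r\le6$ satisfying $e_i\equiv e_j$ mod $3$ for all $i,j$, and $e_i\equiv0$ mod $3$ if $r<6$.
   Context: $G_{34}\subset GL_6(\mathbb C)$ is the Shephard–Todd (Mitchell) group generated by the reflections across the hyperplanes $x_i-x_j=0$ ($i\ne j$), $x_1-\omega x_2=0$, and $x_1+x_2+x_3+x_4+x_5+x_6=0$ in $\mathbb C^6$, where $\omega=e^{2\pi i/3}$. Equivalently, it is generated by all permutation matrices, the matrix that is $\begin{pmatrix}0&\omega^2\\ \omega&0\end{pmatrix}$ on the first two coordinates and the identity on the others, and $I-\frac13J$ with $J$ the all-ones $6\times6$ matrix. Partitions have positive parts. $(\mathbf e)$ denotes the multinomial coefficient $(e_1+\cdots+e_r)!/(e_1!\cdots e_r!)$, and $m_{\mathbf e}$ the monomial symmetric polynomial, i.e. the shortest symmetric polynomial in $x_1,\ldots,x_6$ containing $x_1^{e_1}\cdots x_r^{e_r}$.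 *)

(* Defs.v *)
From mathcomp Require Import all_boot all_order all_algebra.
From mathcomp Require Import reals complex mpoly.
From mathcomp Require trigo.

Set Implicit Arguments.
Unset Strict Implicit.
Unset Printing Implicit Defensive.

Import Order.TTheory GRing.Theory Num.Theory.

Local Open Scope ring_scope.
Local Open Scope complex_scope.

(* The complex numbers are R[i] for an arbitrary model R of the reals. *)

Definition omega (R : realType) : R[i] :=
  let t : R := 2 * trigo.pi / 3 in trigo.cos t +i* trigo.sin t.

(* A row vector a stands for the linear form x |-> a *m x on column vectors.
   The normal to its kernel for the standard Hermitian product is the conjugate
   transpose of a, and reflection a is the unitary involution that negates this
   normal and fixes the hyperplane a *m x = 0. *)
Definition reflection (R : realType) (n : nat) (a : 'rV[R[i]]_n) : 'M[R[i]]_n :=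
  let v := (map_mx Num.conj a)^T in
  1%:M - (2 / (a *m v) 0 0) *: (v *m a).

Inductive generated_group (F : fieldType) (n : nat) (S : 'M[F]_n -> Prop) :
    'M[F]_n -> Prop :=
  | generated_one : generated_group S 1%:M
  | generated_gen g : S g -> generated_group S g
  | generated_mul g h :
      generated_group S g -> generated_group S h -> generated_group S (g *m h)
  | generated_inv g : generated_group S g -> generated_group S (invmx g).

(* Indices start at 0, so x_1 and x_2 are the coordinates 0 and 1. *)
Inductive G34_mirror (R : realType) : 'rV[R[i]]_6 -> Prop :=
  | mirror_diff (i j : 'I_6) :
      i != j -> G34_mirror (delta_mx 0 i - delta_mx 0 j)
  | mirror_omega :
      G34_mirror (delta_mx 0 (inord 0) - omega R *: delta_mx 0 (inord 1))
  | mirror_sum : G34_mirror (const_mx 1).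

Definition G34 (R : realType) : 'M[R[i]]_6 -> Prop :=
  generated_group (fun g => exists2 a, G34_mirror a & g = reflection a).

(* x |-> p (g x) *)
Definition mpoly_act (F : fieldType) (n : nat) (g : 'M[F]_n) (p : {mpoly F[n]}) :
    {mpoly F[n]} :=
  p \mPo [tuple \sum_(j < n) g i j *: 'X_j | i < n].

Definition G_invariant (F : fieldType) (n : nat) (G : 'M[F]_n -> Prop)
    (p : {mpoly F[n]}) : Prop :=
  forall g, G g -> mpoly_act g p = p.

(* Substitution of f for the variables is an isomorphism from the polynomial
   algebra in k variables onto the set A. *)
Definition polynomial_algebra_on (F : fieldType) (n k : nat)
    (A : {mpoly F[n]} -> Prop) (f : k.-tuple {mpoly F[n]}) : Prop :=
  (forall p, A p <-> exists q : {mpoly F[k]}, p = q \mPo f) /\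
  (forall q : {mpoly F[k]}, q \mPo f = 0 -> q = 0).

Definition is_partition (n : nat) (e : seq nat) : bool :=
  [&& sorted geq e, 0%N \notin e & sumn e == n].

Definition multinomial_coef (e : seq nat) : nat :=
  ((sumn e)`! %/ \prod_(x <- e) x`!)%N.

(* The list permutations s has no repetition, so each monomial whose exponents
   are a rearrangement of e, padded with zeros, occurs exactly once. *)
Definition monomial_sym (F : fieldType) (n : nat) (e : seq nat) : {mpoly F[n]} :=
  \sum_(t <- permutations (e ++ nseq (n - size e) 0%N))
     'X_[[multinom nth 0%N t i | i < n]].

Definition congruent_parts (e : seq nat) : bool :=
  all2rel (fun x y => x == y %[mod 3]) e.

(* f6 R k is f_{6k}, meant for 0 < k. The parts of a partition of 6k are at most
   6k, so its partitions into r parts are among the r-tuples over 'I_(6k+1). *)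
Definition f6 (R : realType) (k : nat) : {mpoly R[i][6]} :=
  (1 + (-1) ^+ k * 27 ^+ k.-1 * 5) *: monomial_sym R[i] 6 [:: 6 * k]%N
  + \sum_(1 <= s < k.+1)
      ('C(6 * k, 3 * s)%:R * (1 + (-1) ^+ (k + s) * 27 ^+ k.-1))
        *: monomial_sym R[i] 6 [:: 6 * k - 3 * s; 3 * s]%N
  + \sum_(3 <= r < 7)
      \sum_(t : r.-tuple 'I_(6 * k).+1 |
              let e := map val t in
              [&& is_partition (6 * k) e, congruent_parts e
                & (r < 6)%N ==> all (fun x => 3 %| x)%N e])
        (multinomial_coef (map val t))%:R *: monomial_sym R[i] 6 (map val t).

(* Main.v *)
(* Each f_6k is 1/81 times the sum of the 6k-th powers of the 126 linear forms
   that define the mirrors of G34, scaled to the same length: the 81 forms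
   sum_i w^(a_i) x_i with a_1 = 0 and sum_i a_i = 0 mod 3, and the 45 forms
   theta (x_i - w^c x_j) with theta^2 = -3. The reflections permute these forms
   up to sixth roots of unity, so the f_6k are invariant.

   The Jacobian determinant of any six invariants vanishes on every mirror, hence
   is divisible by the product P of the 126 forms. The Jacobian J of the f_6k is
   nonzero, and its degree is the sum of the 6k - 1, which is 126; so J is a
   constant multiple of P. It follows that the f_6k are algebraically independent,
   and, by Cramer's rule, that the gradient of an invariant p is a combination
   sum_i c_i grad f_i with polynomial coefficients; the c_i are invariants of
   smaller degree. Contracting with x and using Euler's identity, p lies in
   C[f_6, ..., f_42] by induction on the degree. *)

From HB Require Import structures.
Require Import Defs.
From Stdlib Require Import ZArith.
From mathcomp Require Import all_boot all_order all_algebra ssrZ zify ring lra.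
From mathcomp Require Import reals complex mpoly.

Set Implicit Arguments.
Unset Strict Implicit.
Unset Printing Implicit Defensive.

Import Order.TTheory GRing.Theory Num.Theory.

Local Open Scope ring_scope.

(** * Invariants and the Jacobian *)

(** The 126 forms have Eisenstein integer coefficients, so the facts about them are decided by
    computing with pairs of integers: the generating reflections permute them up to units, no two
    are proportional, and each is reached from the generating mirrors by successive reflections.
    Since the reflection in an image of a mirror is a conjugate reflection, the last fact shows that
    an invariant is fixed by all 126 reflections, which divisibility by P requires. That J is
    nonzero is checked at one integer point, modulo a prime.

    The coefficients of f_6k come from the multinomial theorem. Averaging over the 81 words keeps
    the monomials whose exponents are all congruent mod 3, with coefficient 1. The forms theta (x_i
    - w^c x_j) only see monomials in x_i and x_j; summing over c gives 3 theta^(6k) = 3 (-27)^k when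
    3 divides the exponents, that is (-1)^k 27^(k-1) after division by 81. A pure power x_i^(6k)
    meets five pairs, whence the 5; a monomial in two variables meets one pair, with sign (-1)^(3s)
    = (-1)^s. *)

Lemma mpoly_ring_ind (R : comNzRingType) (n : nat) (P : {mpoly R[n]} -> Prop) :
  (forall c, P c%:MP) -> (forall i, P 'X_i) ->
  (forall p q, P p -> P q -> P (p + q)) ->
  (forall p q, P p -> P q -> P (p * q)) -> forall p, P p.
Proof.
move=> PC PX PD PM; elim/mpolyind => [|c m p _ _ Pp]; first by rewrite -mpolyC0.
apply: PD => //; rewrite -mul_mpolyC; apply: (PM) => //.
rewrite mpolyXE_id; apply: big_ind => [||i _]; rewrite -?mpolyC1 //.
elim: (m i) => [|k IHk]; first by rewrite expr0 -mpolyC1.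
by rewrite exprS; apply: PM.
Qed.

Lemma mderivXU (R : nzRingType) (n : nat) (i j : 'I_n) :
  ('X_i : {mpoly R[n]})^`M(j) = (i == j)%:R.
Proof.
rewrite mderivX mnm1E; have [->|_] := eqVneq; last by rewrite scale0r.
by rewrite -[X in (X - _)%MM]add0m addmK mpolyX0 scale1r.
Qed.

Lemma mderiv_comp (R : comNzRingType) (n k : nat) (t : n.-tuple {mpoly R[k]})
    (p : {mpoly R[n]}) (j : 'I_k) :
  (p \mPo t)^`M(j) = \sum_i (p^`M(i) \mPo t) * (tnth t i)^`M(j).
Proof.
elim/mpoly_ring_ind: p => [c|l|p q IHp IHq|p q IHp IHq].
- rewrite comp_mpolyC mderivC big1 // => i _.
  by rewrite mderivC comp_mpoly0 mul0r.
- rewrite comp_mpolyXU -tnth_nth (bigD1 l) //= big1 => [|i neq_il].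
    by rewrite addr0 mderivXU eqxx comp_mpoly1 mul1r.
  by rewrite mderivXU eq_sym (negPf neq_il) comp_mpoly0 mul0r.
- rewrite comp_mpolyD mderivD IHp IHq -big_split; apply: eq_bigr => i _.
  by rewrite mderivD comp_mpolyD mulrDl.
- rewrite rmorphM /= mderivM IHp IHq mulr_suml mulr_sumr -big_split.
  apply: eq_bigr => i _; rewrite mderivM rmorphD !rmorphM /= mulrDl.
  by rewrite mulrAC mulrA.
Qed.

Lemma mderiv_eq0 (F : fieldType) (n : nat) (p : {mpoly F[n]}) :
  [pchar F] =i pred0 -> (forall i, p^`M(i) = 0) -> p = (p@_0)%:MP.
Proof.
move=> /pcharf0P char0 dp0; apply/mpolyP => m; rewrite mcoeffC.
have [->|/eqP nz_m] := eqVneq m 0%MM; first by rewrite mulr1.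
rewrite mulr0; have [i nz_mi] : exists i, m i != 0%N.
  apply/existsP; apply: contra_notT nz_m => /existsPn m0.
  by apply/mnmP => i; rewrite mnm0E; apply/eqP; have := m0 i; rewrite negbK.
have := congr1 (mcoeff (m - U_(i))) (dp0 i).
rewrite mcoeff_deriv mcoeff0 submK; last by rewrite lep1mP.
by move/eqP; rewrite -mulr_natr mulf_eq0 char0 orbF => /eqP.
Qed.

Lemma msize_mderiv (R : nzRingType) (n : nat) (p : {mpoly R[n]}) (i : 'I_n) :
  (msize p^`M(i) <= (msize p).-1)%N.
Proof.
rewrite msizeE big_tnth; apply/bigmax_leqP => /= j _.
set m := tnth _ _; have : m \in msupp p^`M(i) by apply: mem_tnth.
rewrite mcoeff_msupp mcoeff_deriv => nz.
have : (m + U_(i))%MM \in msupp p.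
  by rewrite mcoeff_msupp; apply: contraNneq nz => ->; rewrite mul0rn.
by move=> /msize_mdeg_lt; rewrite mdegD mdeg1 addn1; case: (msize p).
Qed.

Section Jacobian.

Variables (F : fieldType) (n : nat).
Implicit Types (p q : {mpoly F[n]}) (g h : 'M[F]_n) (a : 'rV[F]_n).
Implicit Types (f : 'I_n -> {mpoly F[n]}).

Definition linear_form a : {mpoly F[n]} := \sum_j a 0 j *: 'X_j.

Definition gradient p : 'rV[{mpoly F[n]}]_n := \row_j p^`M(j).

Definition jacobian_mx f : 'M[{mpoly F[n]}]_n := \matrix_(i, j) (f i)^`M(j).

Definition jacobian f : {mpoly F[n]} := \det (jacobian_mx f).

Definition euler p : {mpoly F[n]} := \sum_j 'X_j * p^`M(j).

HB.instance Definition _ g :=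
  GRing.RMorphism.copy (mpoly_act g)
    (comp_mpoly [tuple \sum_(j < n) g i j *: 'X_j | i < n]).

Lemma mpoly_actX g (i : 'I_n) : mpoly_act g 'X_i = \sum_j g i j *: 'X_j.
Proof. by rewrite /mpoly_act comp_mpolyXU -tnth_nth tnth_mktuple. Qed.

Lemma mpoly_actZ g c p : mpoly_act g (c *: p) = c *: mpoly_act g p.
Proof. exact: comp_mpolyZ. Qed.

Lemma mpoly_actC g c : mpoly_act g c%:MP = c%:MP.
Proof. exact: comp_mpolyC. Qed.

Lemma linear_formZ (u : F) a : linear_form (u *: a) = u *: linear_form a.
Proof.
by rewrite scaler_sumr; apply: eq_bigr => i _; rewrite mxE scalerA.
Qed.

Lemma mpoly_act_linear_form g a :
  mpoly_act g (linear_form a) = linear_form (a *m g).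
Proof.
rewrite rmorph_sum /=.
under eq_bigr do rewrite mpoly_actZ mpoly_actX scaler_sumr.
rewrite exchange_big; apply: eq_bigr => j _.
by rewrite mxE scaler_suml; apply: eq_bigr => i _; rewrite scalerA.
Qed.

(** Substituting [g] and then [h] gives x |-> p (g (h x)), so this is a right action. *)
Lemma mpoly_actM g h p : mpoly_act h (mpoly_act g p) = mpoly_act (g *m h) p.
Proof.
elim/mpoly_ring_ind: p => [c|i|p q IHp IHq|p q IHp IHq].
- by rewrite !mpoly_actC.
- have LX g' : mpoly_act g' 'X_i = linear_form (row i g').
    by rewrite mpoly_actX; apply: eq_bigr => j _; rewrite mxE.
  by rewrite !LX mpoly_act_linear_form row_mul.
- by rewrite !rmorphD /= IHp IHq.
- by rewrite !rmorphM /= IHp IHq.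
Qed.

Lemma mpoly_act1 p : mpoly_act 1%:M p = p.
Proof.
rewrite -[RHS]comp_mpoly_id; congr (_ \mPo _); apply: eq_mktuple => i.
rewrite (bigD1 i) //= mxE eqxx scale1r big1 ?addr0 // => j neq_ji.
by rewrite mxE eq_sym (negPf neq_ji) scale0r.
Qed.

Lemma mpoly_act_invmx g p : mpoly_act g p = p -> mpoly_act (invmx g) p = p.
Proof.
(* [invmx] returns a singular matrix unchanged, so in that case the hypothesis is the goal. *)
have [g_unit|g_sing] := boolP (g \in unitmx); last by rewrite /invmx (negPf g_sing).
by move=> pg; rewrite -{1}pg mpoly_actM mulmxV // mpoly_act1.
Qed.

(** Chain rule for a linear substitution: gradients are rows, so [g] multiplies on the right. *)
Lemma gradient_act g p :
  gradient (mpoly_act g p) =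
  map_mx (mpoly_act g) (gradient p) *m map_mx (@mpolyC n F) g.
Proof.
apply/rowP => j; rewrite !mxE mderiv_comp; apply: eq_bigr => i _.
rewrite !mxE tnth_mktuple; congr (_ * _).
rewrite raddf_sum (bigD1 j) //= big1 => [|l neq_lj].
  by rewrite addr0 mderivZ mderivXU eqxx -mul_mpolyC mulr1.
by rewrite mderivZ mderivXU (negPf neq_lj) scaler0.
Qed.

Lemma row_jacobian_mx f i : row i (jacobian_mx f) = gradient (f i).
Proof. by apply/rowP => j; rewrite !mxE. Qed.

Lemma jacobian_mx_act g f : (forall i, mpoly_act g (f i) = f i) ->
  jacobian_mx f = map_mx (mpoly_act g) (jacobian_mx f) *m map_mx (@mpolyC n F) g.
Proof.
move=> fg; apply/row_matrixP => i.
by rewrite row_mul -map_row !row_jacobian_mx -gradient_act fg.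
Qed.

Lemma map_act_mxC (m k : nat) g (A : 'M[F]_(m, k)) :
  map_mx (mpoly_act g) (map_mx (@mpolyC n F) A) = map_mx (@mpolyC n F) A.
Proof. by apply/matrixP => i j; rewrite !mxE mpoly_actC. Qed.

Lemma linear_form_eq0 a : (linear_form a == 0) = (a == 0).
Proof.
apply/eqP/eqP => [La0|->]; last first.
  by apply: big1 => i _; rewrite mxE scale0r.
apply/rowP => j; have := congr1 (mcoeff U_(j)) La0.
rewrite raddf_sum (bigD1 j) //= big1 => [|i neq_ij].
  by rewrite addr0 mcoeffZ mcoeffX eqxx mulr1 mcoeff0 mxE.
by rewrite mcoeffZ mcoeffXU (negPf neq_ij) mulr0.
Qed.


(** The projection along [v] onto the hyperplane of [a]. Acting by it restricts a polynomial to the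
    mirror without a choice of coordinates there. *)
Definition mirror_projection a (v : 'cV[F]_n) : 'M[F]_n :=
  1%:M - ((a *m v) 0 0)^-1 *: (v *m a).

Lemma mirror_projection_form a v : (a *m v) 0 0 != 0 ->
  a *m mirror_projection a v = 0.
Proof.
move=> nz_av; rewrite mulmxBr mulmx1 -scalemxAr mulmxA.
by rewrite [a *m v]mx11_scalar mul_scalar_mx scalerA mxE mulVf ?scale1r ?subrr.
Qed.

(** Modulo [linear_form a] the substitution fixes every variable, hence every polynomial. For a
    projection this is the factor theorem for a linear form. *)
Lemma mpoly_act_sub_dvd a (v : 'cV[F]_n) c p :
  exists q, p = mpoly_act (1%:M - c *: (v *m a)) p + linear_form a * q.
Proof.
set g := 1%:M - _.
elim/mpoly_ring_ind: p => [d|i|p q [p' Ep] [q' Eq]|p q [p' Ep] [q' Eq]].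
- by exists 0; rewrite mpoly_actC mulr0 addr0.
- exists (c * v i 0)%:MP.
  have -> : mpoly_act g 'X_i = 'X_i - (c * v i 0) *: linear_form a.
    rewrite mpoly_actX (eq_bigr (fun j => (i == j)%:R *: 'X_j
      - (c * v i 0) *: (a 0 j *: 'X_j))); last first.
      by move=> j _; rewrite !mxE big_ord1 scalerBl scalerA mulrA.
    rewrite sumrB -scaler_sumr; congr (_ - _).
    rewrite (bigD1 i) //= eqxx scale1r big1 ?addr0 // => j neq_ji.
    by rewrite eq_sym (negPf neq_ji) scale0r.
  by rewrite [linear_form a * _]mulrC mul_mpolyC subrK.
- by exists (p' + q'); rewrite rmorphD mulrDr addrACA -Ep -Eq.
(* Writing g p for the action: p q - (g p) (g q) = (p - g p) (g q) + p (q - g q). *)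
- exists (p' * mpoly_act g q + p * q').
  rewrite rmorphM /= mulrDr addrA mulrA -mulrDl -Ep mulrCA -mulrDr.
  by rewrite -Eq.
Qed.

Lemma mirror_projection_dvd a (v : 'cV[F]_n) p :
  mpoly_act (mirror_projection a v) p = 0 -> exists q, p = linear_form a * q.
Proof.
move=> p0; have [q Eq] := mpoly_act_sub_dvd a v ((a *m v) 0 0)^-1 p.
by exists q; rewrite {1}Eq -/(mirror_projection a v) p0 add0r.
Qed.

Lemma det_eq0_kernel (R : idomainType) (m : nat) (A : 'M[R]_m) (u : 'cV[R]_m) :
  A *m u = 0 -> u != 0 -> \det A = 0.
Proof.
move=> Au0; apply: contraNeq => nz_A; apply/eqP/colP => i.
have /colP/(_ i)/eqP := congr1 (mulmx (\adj A)) Au0.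
by rewrite mulmxA mul_adj_mx mul_scalar_mx mulmx0 !mxE mulf_eq0 (negPf nz_A) => /eqP.
Qed.

(* Restricted to its mirror, a reflection that fixes the f i makes the Jacobian
   matrix kill the normal v. *)
Lemma jacobian_mirror0 a (v : 'cV[F]_n) c f : (a *m v) 0 0 != 0 -> c != 0 ->
  (forall i, mpoly_act (1%:M - c *: (v *m a)) (f i) = f i) ->
  mpoly_act (mirror_projection a v) (jacobian f) = 0.
Proof.
move=> nz_av nz_c; set g := 1%:M - _; set h := mirror_projection a v => fg.
have ah0 : a *m h = 0 by apply: mirror_projection_form.
have gh : g *m h = h.
  by rewrite mulmxBl mul1mx -scalemxAl -mulmxA ah0 mulmx0 scaler0 subr0.
rewrite -det_map_mx; set A := map_mx _ _.
have AgA : A = A *m map_mx (@mpolyC n F) g.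
  rewrite {1}/A (jacobian_mx_act fg) map_mxM map_act_mxC; congr (_ *m _).
  by apply/matrixP => i j; rewrite !mxE /= mpoly_actM gh.
have [k nz_ak] : exists k, a 0 k != 0.
  apply/existsP; apply: contraNT nz_av => /existsPn a0.
  by rewrite mxE big1 // => k _; move/negbNE/eqP: (a0 k) => ->; rewrite mul0r.
have nz_v : map_mx (@mpolyC n F) v != 0.
  apply: contraNneq nz_av => v0; rewrite mxE big1 // => l _.
  have /colP/(_ l)/eqP := v0; rewrite !mxE mpolyC_eq0 => /eqP ->.
  by rewrite mulr0.
apply: det_eq0_kernel nz_v; apply/colP => i.
have /eqP := AgA; rewrite map_mxB map_mx1 mulmxBr mulmx1 eq_sym.
rewrite -subr_eq0 addrAC subrr add0r oppr_eq0 => /eqP/matrixP/(_ i k)/eqP.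
have Eterm l : A i l * map_mx (@mpolyC n F) (c *: (v *m a)) l k =
    A i l * map_mx (@mpolyC n F) v l 0 * (c * a 0 k)%:MP.
  by rewrite !mxE big_ord1 -mulrA -mpolyCM mulrCA.
rewrite !mxE; under eq_bigr => l _ do rewrite Eterm.
rewrite -mulr_suml.
rewrite mulf_eq0 mpolyC_eq0 mulf_eq0 (negPf nz_c) (negPf nz_ak) /= !orbF => /eqP E0.
exact: E0.
Qed.

(** Divide out one form at a time. Restricted to the mirror of a later [b], the form of [a] is still
    nonzero because [a] is not a multiple of [b]; the polynomial ring being a domain, the quotient
    must vanish on that mirror. *)
Lemma prod_linear_form_dvd (co : 'rV[F]_n -> 'cV[F]_n) (rs : seq 'rV[F]_n) p :
    {in rs, forall a, (a *m co a) 0 0 != 0} ->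
    pairwise (fun a b => ~~ (a <= b)%MS) rs ->
    {in rs, forall a, mpoly_act (mirror_projection a (co a)) p = 0} ->
  exists q, p = \prod_(a <- rs) linear_form a * q.
Proof.
elim: rs p => [|a rs IHrs] p nz_rs /= dist_rs p0.
  by exists p; rewrite big_nil mul1r.
have /andP[a_rs {}dist_rs] := dist_rs.
have [q Ep] := mirror_projection_dvd (p0 a (mem_head _ _)).
have [|b b_rs|r Eq] := IHrs q _ dist_rs.
- by move=> b b_rs; apply: nz_rs; rewrite inE b_rs orbT.
- have b_ars : b \in a :: rs by rewrite inE b_rs orbT.
  have /eqP := p0 b b_ars; rewrite Ep rmorphM mulf_eq0 => /orP[|/eqP //].
  rewrite /= mpoly_act_linear_form linear_form_eq0 mulmxBr mulmx1 -scalemxAr mulmxA.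
  rewrite [a *m _]mx11_scalar mul_scalar_mx scalerA subr_eq0 => /eqP Eab.
  by have /allP/(_ b b_rs)/negP[] := a_rs; rewrite Eab scalemx_sub.
by exists r; rewrite big_cons -mulrA -Eq.
Qed.

Lemma msize_linear_form a : a != 0 -> (2 <= msize (linear_form a))%N.
Proof.
rewrite -linear_form_eq0 => nz_La; rewrite ltnNge; apply: contra nz_La.
move=> /msize1_polyC La; rewrite La mpolyC_eq0.
by rewrite raddf_sum big1 //= => j _; rewrite mcoeffZ mcoeffX mnm1_eq0 mulr0.
Qed.

Lemma msize_prod_linear_form (rs : seq 'rV[F]_n) : {in rs, forall a, a != 0} ->
  ((size rs).+1 <= msize (\prod_(a <- rs) linear_form a))%N.
Proof.
elim: rs => [|a rs IHrs] nz_rs; first by rewrite big_nil msize1.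
have nz_a : a != 0 by apply: nz_rs; rewrite mem_head.
have {}IHrs : (size rs < msize (\prod_(b <- rs) linear_form b))%N.
  by apply: IHrs => b b_rs; apply: nz_rs; rewrite inE b_rs orbT.
have nz_prod : \prod_(b <- rs) linear_form b != 0.
  by rewrite -msize_poly_eq0 -lt0n; apply: leq_trans IHrs.
rewrite big_cons msizeM ?linear_form_eq0 //=.
have := msize_linear_form nz_a.
case: (msize (linear_form a)) => [|[|k]] // _.
by rewrite !addSn /= ltnS (leq_trans IHrs) // leq_addl.
Qed.

(** Each Leibniz term takes one first derivative from every row. [msize] is the degree plus one, and
    0 for the zero polynomial. *)
Lemma msize_jacobian f (e : 'I_n -> nat) :
  (forall i, msize (f i) <= (e i).+1)%N ->
  (msize (jacobian f) <= (\sum_i (e i).-1).+1)%N.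
Proof.
move=> fe; apply: leq_trans (msize_sum _ _ _) _.
apply/bigmax_leqP => s _; rewrite mulr_sign (fun_if (fun p => msize p)).
rewrite mmeasureN if_same.
apply: (big_ind2 (fun p k => msize p <= k.+1)%N) => [|p1 m1 p2 m2 le1 le2|i _].
- by rewrite msize1.
- have [->|nz_p1] := eqVneq p1 0; first by rewrite mul0r msize0.
  have [->|nz_p2] := eqVneq p2 0; first by rewrite mulr0 msize0.
  rewrite msizeM // -subn1 leq_subLR add1n.
  by apply: leq_trans (leq_add le1 le2) _; rewrite addSn addnS.
- rewrite mxE; apply: leq_trans (msize_mderiv _ _) _.
  apply: leq_trans _ (leqSpred _); rewrite -subn1 leq_subLR add1n; exact: fe.
Qed.

Lemma eulerZX c m : euler (c *: 'X_[m]) = (mdeg m)%:R * c *: 'X_[m].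
Proof.
rewrite mdegE natr_sum mulr_suml scaler_suml; apply: eq_bigr => j _.
rewrite mderivZ mderivX -!scalerAr -mpolyXD scalerA [c * _]mulrC.
case: (posnP (m j)) => [->|m_gt0]; first by rewrite !mul0r !scale0r.
by rewrite addmC submK // lep1mP -lt0n.
Qed.

Lemma eulerD p q : euler (p + q) = euler p + euler q.
Proof.
by rewrite -big_split; apply: eq_bigr => j _; rewrite mderivD mulrDr.
Qed.

Lemma mcoeff_euler p m : (euler p)@_m = (mdeg m)%:R * p@_m.
Proof.
elim/mpolyind: p => [|c k p _ _ IHp].
  rewrite mcoeff0 mulr0 /euler big1 ?mcoeff0 // => j _.
  by rewrite mderiv0 mulr0.
rewrite eulerD !mcoeffD IHp eulerZX !mcoeffZ mcoeffX mulrDr mulrA.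
by case: eqP => [->|_]; rewrite ?mulr0.
Qed.

Lemma jacobian_mulmx_inj f (u : 'rV[{mpoly F[n]}]_n) :
  jacobian f != 0 -> u *m jacobian_mx f = 0 -> u = 0.
Proof.
move=> nzJ uJ0; apply/rowP => i.
have /rowP/(_ i)/eqP := congr1 (mulmx^~ (\adj (jacobian_mx f))) uJ0.
rewrite /= -mulmxA mul_mx_adj mul_mx_scalar mul0mx !mxE mulf_eq0.
by rewrite -/(jacobian f) (negPf nzJ) => /eqP.
Qed.

(* A relation q of least degree between the f i has partial derivatives that are
   again relations, hence zero. *)
Lemma jacobian_free f (q : {mpoly F[n]}) : [pchar F] =i pred0 ->
  jacobian f != 0 -> q \mPo [tuple f i | i < n] = 0 -> q = 0.
Proof.
move=> char0 nzJ; have [k] := ubnP (msize q); elim: k q => // k IHk q le_qk q0.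
have dq0 i : q^`M(i) = 0.
  have [->|nz_q] := eqVneq q 0; first exact: mderiv0.
  apply: IHk.
    apply: leq_ltn_trans (msize_mderiv _ _) _.
    by rewrite -ltnS prednK // lt0n msize_poly_eq0.
  pose u : 'rV_n := \row_i (q^`M(i) \mPo [tuple f i | i < n]).
  have /rowP/(_ i) : u = 0; last by rewrite !mxE.
  apply: (jacobian_mulmx_inj nzJ); apply/rowP => j.
  rewrite [RHS]mxE -(mderiv0 _ j) -q0 mderiv_comp mxE.
  by apply: eq_bigr => l _; rewrite !mxE tnth_mktuple.
have Eq := mderiv_eq0 char0 dq0; move: q0; rewrite Eq comp_mpolyC => /eqP.
by rewrite mpolyC_eq0 => /eqP ->.
Qed.

(** Entry [i] of [gradient p] times the adjugate is the expansion along row [i] of the Jacobian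
    determinant with [f i] replaced by [p]. *)
Lemma cramer_gradient f p :
  \row_i jacobian (fun j => if j == i then p else f j) *m jacobian_mx f =
  jacobian f *: gradient p.
Proof.
rewrite -mul_mx_scalar -mul_adj_mx mulmxA; congr (_ *m _).
apply/rowP => i; rewrite !mxE /jacobian (expand_det_row _ i).
apply: eq_bigr => j _; rewrite [gradient p 0 j]mxE [(\adj _) j i]mxE.
rewrite [jacobian_mx _ i j]mxE eqxx /cofactor.
suff -> : row' i (col' j (jacobian_mx (fun k => if k == i then p else f k))) =
          row' i (col' j (jacobian_mx f)) by [].
by apply/matrixP => k l; rewrite !mxE eq_sym (negPf (neq_lift _ _)).
Qed.

(** * The Jacobian criterion for a polynomial algebra of invariants *)

Section Invariants.

Variables (G : 'M[F]_n -> Prop).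
Variables (f : 'I_n -> {mpoly F[n]}) (e : 'I_n -> nat).
Variables (co : 'rV[F]_n -> 'cV[F]_n) (rs : seq 'rV[F]_n).
Hypothesis char0 : [pchar F] =i pred0.
Hypothesis f_inv : forall i, G_invariant G (f i).
Hypothesis f_euler : forall i, euler (f i) = (e i)%:R *: f i.
Hypothesis f_size : forall i, (msize (f i) <= (e i).+1)%N.
Hypothesis e_gt0 : forall i, (0 < e i)%N.
Hypothesis nz_rs : {in rs, forall a, (a *m co a) 0 0 != 0}.
Hypothesis dist_rs : pairwise (fun a b => ~~ (a <= b)%MS) rs.
Hypothesis rs_inv : {in rs, forall a, exists2 c, c != 0 &
  forall p, G_invariant G p -> mpoly_act (1%:M - c *: (co a *m a)) p = p}.
Hypothesis size_rs : size rs = (\sum_i (e i).-1)%N.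
Hypothesis nzJ : jacobian f != 0.

(** Stated for any family of invariants because it serves twice: for [f] itself, and for [f] with
    one member replaced by an arbitrary invariant. *)
Lemma prod_mirror_dvd_jacobian (h : 'I_n -> {mpoly F[n]}) :
  (forall i, G_invariant G (h i)) ->
  exists q, jacobian h = \prod_(a <- rs) linear_form a * q.
Proof.
move=> h_inv; apply: (prod_linear_form_dvd nz_rs dist_rs) => a a_rs.
have [c nz_c act_c] := rs_inv a_rs.
by apply: (jacobian_mirror0 _ nz_c) => [|i]; [apply: nz_rs | apply: act_c].
Qed.

Lemma nz_mirror : {in rs, forall a, a != 0}.
Proof.
move=> a /nz_rs; apply: contraNneq => ->.
by rewrite mul0mx mxE.
Qed.

Lemma jacobian_prod_mirror :
  exists2 k, k != 0 & \prod_(a <- rs) linear_form a = k *: jacobian f.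
Proof.
have [q Jq] := prod_mirror_dvd_jacobian f_inv.
have nz_q : q != 0 by apply: contraNneq nzJ => q0; rewrite Jq q0 mulr0.
have nz_prod : \prod_(a <- rs) linear_form a != 0.
  by apply: contraNneq nzJ => p0; rewrite Jq p0 mul0r.
(* The product of the forms has degree at least [size rs], the Jacobian at most the sum of the
   [(e i).-1]; by [size_rs] these agree, leaving degree 0 for [q]. *)
have q_le1 : (msize q <= 1)%N.
  have := msize_jacobian f_size; rewrite -size_rs Jq msizeM //.
  have := msize_prod_linear_form nz_mirror.
  case: (msize _) => [|m] //; rewrite ltnS addSn /= => le_m le_mq.
  by rewrite -(leq_add2l m) addn1 (leq_trans le_mq).
have Eq := msize1_polyC q_le1; exists (q@_0)^-1.
  by rewrite invr_eq0; apply: contraNneq nz_q => q0; rewrite Eq q0 mpolyC0.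
rewrite Jq Eq mcoeffC eqxx mulr1 mulrC mul_mpolyC scalerA mulVf ?scale1r //.
by apply: contraNneq nz_q => q0; rewrite Eq q0 mpolyC0.
Qed.

Lemma gradient_decomposition p : G_invariant G p -> (1 < msize p)%N ->
  exists2 u : 'rV[{mpoly F[n]}]_n, gradient p = u *m jacobian_mx f &
    forall i : 'I_n, G_invariant G (u 0 i) /\ (msize (u 0%R i) < msize p)%N.
Proof.
move=> p_inv p_gt1; have [k nz_k prodE] := jacobian_prod_mirror.
pose h i j := if j == i then p else f j.
have h_inv i j : G_invariant G (h i j) by rewrite /h; case: ifP.
have dvd_h i : exists q, jacobian (h i) = jacobian f * q.
  have [q ->] := prod_mirror_dvd_jacobian (h_inv i).
  by exists (k *: q); rewrite prodE -scalerAl -scalerAr.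
have [u hu] : exists u : 'rV[{mpoly F[n]}]_n,
    forall i, jacobian (h i) = jacobian f * u 0 i.
  have /fin_all_exists[c hc] := dvd_h.
  by exists (\row_i c i) => i; rewrite mxE.
have gradE : gradient p = u *m jacobian_mx f.
  apply/rowP => j; apply: (mulfI nzJ).
  have /rowP/(_ j) := cramer_gradient f p; rewrite [RHS]mxE => <-.
  have -> : \row_i jacobian (h i) = jacobian f *: u.
    by apply/rowP => i; rewrite !mxE hu.
  by rewrite -scalemxAl mxE.
exists u => // i; split.
  (* Both [gradient p] and [jacobian_mx f] transform by right multiplication with [g], so the
     transformed [u] solves the same linear system, whose solution is unique. *)
  move=> g Gg; have u_act : map_mx (mpoly_act g) u - u = 0.
    apply: (jacobian_mulmx_inj nzJ); apply/eqP; rewrite mulmxBl subr_eq0 -gradE.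
    rewrite {1}(jacobian_mx_act (fun i => f_inv i Gg)) mulmxA -map_mxM -gradE.
    by rewrite -gradient_act p_inv.
  by have /rowP/(_ i)/eqP := u_act; rewrite !mxE subr_eq0 => /eqP.
have [->|nz_ui] := eqVneq (u 0 i) 0; first by rewrite msize0 (ltn_trans _ p_gt1).
(* [jacobian (h i)] has degree at most deg p - 1 plus the sum of e_j - 1 over j != i, while
   [jacobian f] has degree at least the sum of all e_j - 1. So [u 0 i] has degree at most deg p -
   e_i, which is smaller as e_i > 0. *)
have size_h j : (msize (h i j) <= (if j == i then (msize p).-1 else e j).+1)%N.
  by rewrite /h; case: ifP => // _; apply: leqSpred.
have := msize_jacobian size_h; rewrite hu msizeM //.
have := msize_prod_linear_form nz_mirror; rewrite prodE msizeZ // size_rs.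
rewrite (bigD1 i) //= => le_m; rewrite (bigD1 i) //= eqxx.
rewrite (eq_bigr (fun j => (e j).-1)) => [|j /negPf->//].
move: le_m; case: (msize (jacobian f)) => [|m] //; rewrite ltnS addSn /=.
case: (msize p) p_gt1 => [|[|d]] //= _.
case: (e i) (e_gt0 i) => [|ei] //= _ le_m; rewrite ltnS.
set s := (\sum_(j | _) _)%N in le_m *.
move=> le_mu; have := leq_trans (leq_add le_m (leqnn _)) le_mu.
by rewrite addnAC -addSn leq_add2r => /(leq_trans (leq_addl _ _)).
Qed.

(* Euler's identity turns the decomposition of the gradient into one of
   [euler p], and [euler p - D p] has smaller degree than [p]. *)
Lemma invariant_in_subalgebra p : G_invariant G p ->
  exists q : {mpoly F[n]}, p = q \mPo [tuple f i | i < n].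
Proof.
have [d] := ubnP (msize p); elim: d p => // d IHd p le_pd p_inv.
have [p_le1|p_gt1] := leqP (msize p) 1.
  by exists (p@_0)%:MP; rewrite comp_mpolyC -msize1_polyC.
have [u gradE uP] := gradient_decomposition p_inv p_gt1.
have /fin_all_exists[q qE] i :
    exists q : {mpoly F[n]}, u 0 i = q \mPo [tuple f j | j < n].
  have [u_inv u_lt] := uP i; apply: IHd u_inv.
  exact: leq_trans u_lt (le_pd).
pose D := (msize p).-1.
have eulerE : euler p = \sum_i (e i)%:R *: (u 0 i * f i).
  rewrite /euler (eq_bigr (fun j => \sum_i u 0 i * ('X_j * (f i)^`M(j)))).
    rewrite exchange_big; apply: eq_bigr => i _; rewrite -mulr_sumr.
    by rewrite -/(euler (f i)) f_euler scalerAr.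
  move=> j _; have /rowP/(_ j) := gradE; rewrite !mxE => ->.
  by rewrite mulr_sumr; apply: eq_bigr => i _; rewrite mxE mulrCA.
pose r := euler p - D%:R *: p.
have r_inv : G_invariant G r.
  move=> g Gg; rewrite /r rmorphB /= mpoly_actZ p_inv // eulerE rmorph_sum.
  congr (_ - _); apply: eq_bigr => i _.
  by rewrite /= mpoly_actZ rmorphM /= (f_inv i Gg) (uP i).1.
have r_lt : (msize r < d)%N.
  apply: leq_trans (_ : msize p <= d)%N => //.
  rewrite -[msize p]prednK ?(ltnW p_gt1) // ltnS msizeE big_tnth.
  apply/bigmax_leqP => /= j _; set m := tnth _ _.
  have : m \in msupp r by apply: mem_tnth.
  rewrite mcoeff_msupp mcoeffB mcoeffZ mcoeff_euler -mulrBl mulf_eq0 negb_or.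
  case/andP=> neq_mD; rewrite -mcoeff_msupp => /msize_mdeg_lt m_lt.
  rewrite ltn_neqAle -ltnS prednK ?(ltnW p_gt1) // m_lt andbT.
  by apply: contraNneq neq_mD => ->; rewrite subrr.
have [s sE] := IHd r r_lt r_inv.
exists ((D%:R)^-1 *: (\sum_i (e i)%:R *: (q i * 'X_i) - s)).
have -> : p = D%:R^-1 *: (euler p - r).
  rewrite opprB addrC subrK scalerA mulVf ?scale1r //.
  by have /pcharf0P -> := char0; rewrite /D -lt0n; case: (msize p) p_gt1 => [|[]].
rewrite comp_mpolyZ comp_mpolyB -sE eulerE rmorph_sum; congr (_ *: (_ - _)).
apply: eq_bigr => i _; rewrite /= comp_mpolyZ rmorphM /= comp_mpolyXU -tnth_nth.
by rewrite tnth_mktuple -qE.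
Qed.

Theorem jacobian_criterion :
  polynomial_algebra_on (G_invariant G) [tuple f i | i < n].
Proof.
split=> [p|q]; last exact: jacobian_free.
split=> [|[q ->]]; first exact: invariant_in_subalgebra.
move=> g Gg; elim/mpoly_ring_ind: q => [c|i|q1 q2 IH1 IH2|q1 q2 IH1 IH2].
- by rewrite comp_mpolyC mpoly_actC.
- by rewrite comp_mpolyXU -tnth_nth tnth_mktuple; apply: f_inv.
- by rewrite comp_mpolyD rmorphD /= IH1 IH2.
- by rewrite rmorphM /= rmorphM /= IH1 IH2.
Qed.

End Invariants.

End Jacobian.

(** * The mirrors over the Eisenstein integers *)

Delimit Scope Z_scope with BZ.

(* (a, b) stands for the Eisenstein integer a + b omega. *)
Definition eis := (Z * Z)%type.

Definition eis_add (x y : eis) : eis := (x.1 + y.1, x.2 + y.2)%BZ.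
Definition eis_opp (x : eis) : eis := (- x.1, - x.2)%BZ.
(** Reduced with omega^2 = - 1 - omega. *)
Definition eis_mul (x y : eis) : eis :=
  (x.1 * y.1 - x.2 * y.2, x.1 * y.2 + x.2 * y.1 - x.2 * y.2)%BZ.
Definition eis_conj (x : eis) : eis := (x.1 - x.2, - x.2)%BZ.
Definition eis_sum (s : seq eis) : eis := foldr eis_add (0, 0)%BZ s.
Definition eis_exp (x : eis) (n : nat) : eis := iter n (eis_mul x) (1, 0)%BZ.

Definition omega_pow (c : nat) : eis :=
  nth (0, 0)%BZ [:: (1, 0); (0, 1); (-1, -1)]%BZ c.

(* theta = omega - omega^2 is a square root of -3. *)
Definition theta : eis := (1, 2)%BZ.

Definition eis_units : seq eis :=
  [:: (1, 0); (-1, 0); (0, 1); (0, -1); (-1, -1); (1, 1)]%BZ.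

(* The form theta (x_i - omega^c x_j). The factor theta gives it the squared
   length 6 of the forms [word_root w]. *)
Definition pair_root (i j c : nat) : seq eis :=
  [seq if k == i then theta
       else if k == j then eis_opp (eis_mul theta (omega_pow c)) else (0, 0)%BZ
  | k <- iota 0 6].

Definition word_root (w : seq nat) : seq eis := [seq omega_pow c | c <- w].

Fixpoint words (n : nat) : seq (seq nat) :=
  if n is m.+1 then [seq c :: w | c <- iota 0 3, w <- words m] else [:: [::]].

Definition index_pairs : seq (nat * nat) :=
  [seq p <- [seq (i, j) | i <- iota 0 6, j <- iota 0 6] | (p.1 < p.2)%N].

Definition pair_roots : seq (seq eis) :=
  [seq pair_root p.1 p.2 c | p <- index_pairs, c <- iota 0 3].

(** Multiplying a form by omega adds 1 to all six letters and keeps their sum mod 3; fixing the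
    first letter to 0 picks one form from each such class. *)
Definition word_roots : seq (seq eis) :=
  [seq word_root (0%N :: w) | w <- words 5 & (3 %| sumn w)%N].

Definition mirrors : seq (seq eis) := pair_roots ++ word_roots.

Definition generators : seq (seq eis) :=
  [seq pair_root p.1 p.2 0 | p <- index_pairs]
  ++ [:: pair_root 0 1 1; word_root (nseq 6 0%N)].

Definition herm (b a : seq eis) : eis :=
  eis_sum [seq eis_mul p.1 (eis_conj p.2) | p <- zip b a].

Definition combine (x : eis) (b : seq eis) (y : eis) (a : seq eis) : seq eis :=
  [seq eis_add (eis_mul x p.1) (eis_mul y p.2) | p <- zip b a].

Definition scale_root (x : eis) (b : seq eis) : seq eis := map (eis_mul x) b.

(* Scales b by a unit so that its first nonzero entry is 1 or theta, as in
   [mirrors]. *)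
Definition normalize (b : seq eis) : seq eis :=
  let x := head (0, 0)%BZ [seq x <- b | x != (0, 0)%BZ] in
  let good u := (eis_mul u x == (1, 0)%BZ) || (eis_mul u x == theta) in
  scale_root (head (1, 0)%BZ (filter good eis_units)) b.

(* For a of squared length 6 the reflection in a sends b to b - (<b, a> / 3) a.
   Nothing relies on the divisions being exact: [reflects] certifies the result
   up to a unit. *)
Definition reflect_root (a b : seq eis) : seq eis :=
  let h := herm b a in
  normalize (combine (1, 0)%BZ b (- (h.1 / 3), - (h.2 / 3))%BZ a).

(** The relation c = u (b - (<b, a> / 3) a) with denominators cleared, so that it is an identity of
    Eisenstein integers. The factor 1/3 is 2 / <a, a> for squared length 6. *)
Definition reflects (a b c : seq eis) : bool :=
  has (fun u => scale_root (3, 0)%BZ c ==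
    combine (eis_mul u (3, 0)%BZ) b (eis_opp (eis_mul u (herm b a))) a) eis_units.

(* Need not be injective: sorting is only used to compare two lists up to
   permutation. *)
Definition root_key (b : seq eis) : Z :=
  foldl (fun k x => k * 64 + x.1 * 8 + x.2)%BZ 0%BZ b.

Definition sort_roots := sort (fun a b => Z.leb (root_key a) (root_key b)).

Definition root_like (a : seq eis) : bool :=
  (size a == 6) && (herm a a == (6, 0)%BZ).

Definition permutes_mirrors (a : seq eis) : bool :=
  (sort_roots [seq reflect_root a b | b <- mirrors] == sort_roots mirrors) &&
  all (fun b => reflects a b (reflect_root a b)) mirrors.

(* Each b in l is mapped by the reflection in some earlier mirror to another
   earlier one. *)
Fixpoint reachable (known l : seq (seq eis)) : bool :=
  if l is b :: l' then
    has (fun a => let c := reflect_root a b in (c \in known) && reflects a b c)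
      known && reachable (b :: known) l'
  else true.

Definition independent (a b : seq eis) : bool :=
  has (fun i => has (fun j =>
    eis_mul (nth (0, 0)%BZ a i) (nth (0, 0)%BZ b j) !=
    eis_mul (nth (0, 0)%BZ a j) (nth (0, 0)%BZ b i)) (iota 0 6)) (iota 0 6).

(* A point on no mirror. *)
Definition point : seq eis :=
  [:: (-2, 0); (-1, 0); (0, 0); (1, 0); (2, 0); (4, 0)]%BZ.

Definition eis_dot (a b : seq eis) : eis :=
  eis_sum [seq eis_mul p.1 p.2 | p <- zip a b].

(** The gradient at [point] of the sum of the 6k-th powers of the forms, with the common factor 6k
    left out. *)
Definition gradient_value (k : nat) : seq eis :=
  let ps := [seq (b, eis_exp (eis_dot b point) (6 * k).-1) | b <- mirrors] in
  [seq eis_sum [seq eis_mul p.2 (nth (0, 0)%BZ p.1 j) | p <- ps] | j <- iota 0 6].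

(** * Unitary reflections over a closed field with conjugation *)

Section Reflections.

Variables (C : numClosedFieldType) (n : nat).

(** The formula of [reflection] over an abstract field; over [R[i]] the two agree by conversion. *)
Definition mirror_reflection (a : 'rV[C]_n) : 'M[C]_n :=
  let v := (map_mx Num.conj a)^T in
  1%:M - (2 / (a *m v) 0 0) *: (v *m a).

Lemma reflectionZ (u : C) (a : 'rV[C]_n) : u != 0 ->
  mirror_reflection (u *: a) = mirror_reflection a.
Proof.
move=> nz_u; have vE : (map_mx Num.conj (u *: a))^T = u^* *: (map_mx Num.conj a)^T.
  by rewrite map_mxZ; apply: linearZ.
set v := (map_mx Num.conj a)^T in vE *.
have nE : ((u *: a) *m (u^* *: v)) 0 0 = u * u^* * (a *m v) 0 0.
  by rewrite -scalemxAl -scalemxAr scalerA mxE.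
rewrite /mirror_reflection vE nE -/v -scalemxAl -scalemxAr !scalerA; congr (_ - _ *: _).
have nz_cu : u^* != 0 by rewrite conjC_eq0.
(* For squared length 0 both scalars are 0, the inverse of 0 being 0. *)
have [->|nz_av] := eqVneq ((a *m v) 0 0) 0.
  by rewrite !(mulr0, invr0, mul0r).
by field; rewrite nz_av nz_cu.
Qed.

Lemma conj_mxM (m k p : nat) (A : 'M[C]_(m, k)) (B : 'M[C]_(k, p)) :
  (map_mx Num.conj (A *m B))^T = (map_mx Num.conj B)^T *m (map_mx Num.conj A)^T.
Proof. by rewrite map_mxM trmx_mul. Qed.

Lemma conj_mxK (m k : nat) (A : 'M[C]_(m, k)) :
  map_mx Num.conj (map_mx Num.conj A)^T = A^T.
Proof. by apply/matrixP => i j; rewrite !mxE conjCK. Qed.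

Lemma reflection_hermitian (a : 'rV[C]_n) :
  (map_mx Num.conj (mirror_reflection a))^T = mirror_reflection a.
Proof.
rewrite /mirror_reflection; set v := (map_mx Num.conj a)^T.
rewrite map_mxB map_mx1 map_mxZ linearB linearZ /= trmx1 conj_mxM.
rewrite conj_mxK trmxK -/v; congr (_ - _ *: _).
rewrite rmorphM fmorphV rmorph_nat; congr (_ / _).
have /matrixP/(_ 0 0) : (map_mx Num.conj (a *m v))^T = a *m v.
  by rewrite conj_mxM conj_mxK trmxK.
by rewrite mxE mxE.
Qed.

Lemma reflectionK (a : 'rV[C]_n) : mirror_reflection a *m mirror_reflection a = 1%:M.
Proof.
rewrite /mirror_reflection; set v := (map_mx Num.conj a)^T; set d := (a *m v) 0 0.
have [d0|nz_d] := eqVneq d 0.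
  by rewrite d0 invr0 mulr0 scale0r subr0 mulmx1.
rewrite mulmxBl mul1mx mulmxBr mulmx1 -!scalemxAl -!scalemxAr mulmxA.
rewrite -[v *m a *m v]mulmxA [a *m v]mx11_scalar -/d mul_mx_scalar -scalemxAl.
have -> : (2 / d) *: ((2 / d) *: (d *: (v *m a))) =
    (2 / d) *: (v *m a) + (2 / d) *: (v *m a).
  by rewrite !scalerA -scalerDl; congr (_ *: _); field.
by rewrite opprB addrK subrK.
Qed.

(** The reflection s in [a] is Hermitian and an involution, hence unitary: the normal of [b *m s] is
    s times the normal of [b], and the squared length does not change. *)
Lemma reflection_conjugate (a b : 'rV[C]_n) :
  mirror_reflection (b *m mirror_reflection a) =
  mirror_reflection a *m mirror_reflection b *m mirror_reflection a.
Proof.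
rewrite {1}/mirror_reflection conj_mxM reflection_hermitian.
have := reflectionK a; set s := mirror_reflection a => ss; clearbody s.
rewrite /mirror_reflection; set v := (map_mx Num.conj b)^T.
have -> : b *m s *m (s *m v) = b *m v.
  by rewrite mulmxA -[b *m s *m s]mulmxA ss mulmx1.
rewrite mulmxBr mulmx1 mulmxBl ss; congr (_ - _).
by rewrite -scalemxAr -scalemxAl !mulmxA.
Qed.

End Reflections.

(** * Eisenstein integers as elements of the field *)

Section EisensteinValue.

Variables (C : numClosedFieldType) (w : C).
Hypothesis w_root : w ^+ 2 + w + 1 = 0.

Definition Zr (z : Z) : C := (int_of_Z z)%:~R.

Lemma ZrD x y : Zr (x + y)%BZ = Zr x + Zr y.
Proof. by rewrite /Zr (rmorphD int_of_Z x y) rmorphD. Qed.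

Lemma ZrN x : Zr (- x)%BZ = - Zr x.
Proof. by rewrite /Zr (rmorphN int_of_Z x) rmorphN. Qed.

Lemma ZrM x y : Zr (x * y)%BZ = Zr x * Zr y.
Proof. by rewrite /Zr (rmorphM int_of_Z x y) rmorphM. Qed.

Lemma ZrB x y : Zr (x - y)%BZ = Zr x - Zr y.
Proof. by rewrite /Z.sub ZrD ZrN. Qed.

Lemma Zr_eq0 x : (Zr x == 0) = (x == 0%BZ).
Proof. by rewrite /Zr intr_eq0 -(can_eq int_of_ZK). Qed.

Definition eis_val (x : eis) : C := Zr x.1 + Zr x.2 * w.

Lemma w_sqr : w ^+ 2 = - w - 1.
Proof. by apply/eqP; rewrite -subr_eq0 opprD !opprK addrA w_root. Qed.

Lemma w_cube : w ^+ 3 = 1.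
Proof. by rewrite exprS w_sqr mulrBr mulrN mulr1 -expr2 w_sqr; ring. Qed.

Lemma conj_w : w^* = - w - 1.
Proof.
have normw : `|w| = 1.
  apply/eqP; rewrite -(@pexpr_eq1 _ _ 3) ?normr_ge0 //.
  by rewrite -normrX w_cube normr1.
have nz_w : w != 0 by rewrite -normr_eq0 normw oner_eq0.
by apply: (mulfI nz_w); rewrite -normCK normw -w_sqr -exprS w_cube expr1n.
Qed.

Lemma eis_valD x y : eis_val (eis_add x y) = eis_val x + eis_val y.
Proof. rewrite /eis_val /= !ZrD; ring. Qed.

Lemma eis_valN x : eis_val (eis_opp x) = - eis_val x.
Proof. rewrite /eis_val /= !ZrN; ring. Qed.

Lemma eis_valM x y : eis_val (eis_mul x y) = eis_val x * eis_val y.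
Proof.
rewrite /eis_val /= !(ZrD, ZrB, ZrM).
transitivity (Zr x.1 * Zr y.1 + (Zr x.1 * Zr y.2 + Zr x.2 * Zr y.1) * w
  + Zr x.2 * Zr y.2 * (- w - 1)); first ring.
rewrite -w_sqr; ring.
Qed.

Lemma eis_val0 : eis_val (0, 0)%BZ = 0.
Proof. by rewrite /eis_val /= mul0r addr0. Qed.

Lemma eis_val1 : eis_val (1, 0)%BZ = 1.
Proof. by rewrite /eis_val /= mul0r addr0. Qed.

Lemma eis_val_conj x : eis_val (eis_conj x) = (eis_val x)^*.
Proof.
rewrite /eis_val /= rmorphD rmorphM /= conj_w /Zr !rmorph_int -!/(Zr _).
rewrite ZrB ZrN; ring.
Qed.

(** The product with the conjugate is the integer a^2 - a b + b^2, a form that vanishes only at (0,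
    0). *)
Lemma eis_val_eq0 x : (eis_val x == 0) = (x == (0, 0)%BZ).
Proof.
apply/eqP/eqP => [x0|->]; last exact: eis_val0.
have := eis_valM x (eis_conj x); rewrite x0 mul0r {1}/eis_val /= => /eqP.
rewrite (_ : (_ + _ - _)%BZ = 0%BZ) ?mul0r ?addr0; last by lia.
by rewrite Zr_eq0 => /eqP; case: x {x0} => a b /= ab; congr (_, _); nia.
Qed.

Lemma eis_val_sum s : eis_val (eis_sum s) = \sum_(x <- s) eis_val x.
Proof.
elim: s => [|x s IHs]; first by rewrite big_nil eis_val0.
by rewrite big_cons -IHs -eis_valD.
Qed.

Lemma eis_val_exp x n : eis_val (eis_exp x n) = eis_val x ^+ n.
Proof.
elim: n => [|n IHn]; first exact: eis_val1.
by rewrite exprS -IHn -eis_valM.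
Qed.

Lemma eis_val_omega_pow c : (c < 3)%N -> eis_val (omega_pow c) = w ^+ c.
Proof.
case: c => [|[|[|]]] // _; rewrite /eis_val /=.
- by rewrite mul0r addr0.
- by rewrite add0r mul1r.
- by rewrite w_sqr mulN1r addrC.
Qed.

Lemma eis_unit_exp6 u : u \in eis_units -> eis_val u ^+ 6 = 1.
Proof.
have w6 : w ^+ 6 = 1 by rewrite (exprM w 3 2) w_cube expr1n.
have w2_6 : (- w - 1) ^+ 6 = 1 by rewrite -w_sqr -exprM (exprM w 3 4) w_cube expr1n.
rewrite !inE /eis_val => /or4P[/eqP->|/eqP->|/eqP->|/or3P[/eqP->|/eqP->|/eqP->]] /=.
- by rewrite mul0r addr0 expr1n.
- by rewrite mul0r addr0 -signr_odd.
- by rewrite add0r mul1r.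
- by rewrite add0r mulN1r exprNn w6 -signr_odd mulr1.
- by rewrite mulN1r addrC.
- by rewrite mul1r -[1 + w]opprK opprD addrC exprNn w2_6 -signr_odd mulr1.
Qed.

Definition root_vec (b : seq eis) : 'rV[C]_6 := \row_i eis_val (nth (0, 0)%BZ b i).

Lemma sum_zip6 (f : eis * eis -> C) a b : size a = 6 -> size b = 6 ->
  \sum_(p <- zip a b) f p =
  \sum_(i < 6) f (nth (0, 0)%BZ a i, nth (0, 0)%BZ b i).
Proof.
move=> sa sb; rewrite (big_nth ((0, 0), (0, 0))%BZ) size_zip sa sb big_mkord.
by apply: eq_bigr => i _; rewrite nth_zip ?sa ?sb.
Qed.

Lemma herm_val a b : size a = 6 -> size b = 6 ->
  (root_vec b *m (map_mx Num.conj (root_vec a))^T) 0 0 = eis_val (herm b a).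
Proof.
move=> sa sb; rewrite eis_val_sum big_map sum_zip6 // mxE.
by apply: eq_bigr => i _; rewrite !mxE eis_valM eis_val_conj.
Qed.

Lemma root_vec_combine x b y a : size a = 6 -> size b = 6 ->
  root_vec (combine x b y a) = eis_val x *: root_vec b + eis_val y *: root_vec a.
Proof.
move=> sa sb; apply/rowP => i; rewrite !mxE.
rewrite (nth_map ((0, 0), (0, 0))%BZ) ?size_zip ?sa ?sb // nth_zip ?sa ?sb //=.
by rewrite eis_valD !eis_valM.
Qed.

Lemma root_vec_scale x b : root_vec (scale_root x b) = eis_val x *: root_vec b.
Proof.
apply/rowP => i; rewrite !mxE -eis_valM; have [lt_ib|le_bi] := ltnP i (size b).
  by rewrite (nth_map (0, 0)%BZ).
by rewrite !nth_default ?size_map // /eis_mul /= !Z.mul_0_r.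
Qed.

Lemma independentP a b : independent a b -> ~~ (root_vec a <= root_vec b)%MS.
Proof.
case/hasP=> i; rewrite mem_iota add0n => /andP[_ i_lt6] /hasP[j].
rewrite mem_iota add0n => /andP[_ j_lt6]; apply: contraNN => /sub_rVP[t abE].
have aE k : (k < 6)%N -> eis_val (nth (0, 0)%BZ a k) = t * eis_val (nth (0, 0)%BZ b k).
  by move=> k_lt6; have /rowP/(_ (Ordinal k_lt6)) := abE; rewrite !mxE.
set x := eis_mul _ _; set y := eis_mul _ _.
have : eis_val (eis_add x (eis_opp y)) == 0.
  by rewrite eis_valD eis_valN !eis_valM !aE // subr_eq0 mulrAC.
rewrite eis_val_eq0; case: x y => [x1 x2] [y1 y2] /=; rewrite !xpair_eqE /=.
by move=> /andP[/eqP xy1 /eqP xy2]; apply/andP; split; apply/eqP; lia.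
Qed.

Lemma root_like_norm a : root_like a ->
  (root_vec a *m (map_mx Num.conj (root_vec a))^T) 0 0 = 6%:R.
Proof.
case/andP=> /eqP sa /eqP na; rewrite herm_val // na.
by rewrite /eis_val /= mul0r addr0.
Qed.

Lemma reflectsP a b c : root_like a -> size b = 6 -> reflects a b c ->
  exists2 u : C, u ^+ 6 = 1 &
    root_vec c = u *: (root_vec b *m mirror_reflection (root_vec a)).
Proof.
move=> ra sb; have /andP[/eqP sa _] := ra.
case/hasP=> u u_unit /eqP/(congr1 root_vec).
rewrite root_vec_scale root_vec_combine //.
rewrite eis_valN !eis_valM => cE.
exists (eis_val u); first exact: eis_unit_exp6.
have E3 : eis_val (3, 0)%BZ = 3%:R :> C by rewrite /eis_val /= mul0r addr0.
have nz3 : 3%:R != 0 :> C by rewrite pnatr_eq0.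
apply: (scalerI nz3); rewrite -E3 cE E3 /mirror_reflection root_like_norm //.
rewrite mulmxBr mulmx1 -scalemxAr mulmxA [_ *m (map_mx _ _)^T]mx11_scalar.
rewrite herm_val // mul_scalar_mx !scalerBr !scalerA mulrC -scaleNr.
by congr (_ + _ *: _); field.
Qed.


End EisensteinValue.


(** The addition formulas for 3 t = 2 pi give omega^3 = 1, and sin t > 0 excludes omega = 1; the
    remaining factor of omega^3 - 1 must vanish. *)
Lemma omega_root (R : realType) : omega R ^+ 2 + omega R + 1 = 0.
Proof.
pose t : R := 2 * trigo.pi / 3; have t3 : t *+ 3 = trigo.pi *+ 2.
  by rewrite /t -[LHS]mulr_natr -[RHS]mulr_natl; field.
have w_cube : omega R ^+ 3 = 1.
  rewrite /omega -/t !exprS expr0 mulr1; simpc.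
  have := trigo.cos2pi R; have := trigo.sin2pi R.
  rewrite -t3 mulrS mulr2n !(trigo.cosD, trigo.sinD).
  move=> s0 c1; apply/eqP; rewrite eq_complex /=.
  by apply/andP; split; apply/eqP; [rewrite -[RHS]c1 | rewrite -[RHS]s0]; ring.
have sin_gt0 : 0 < trigo.sin t.
  have pi_gt0 := trigo.pi_gt0 R.
  apply: trigo.sin_gt0_pi; apply/andP; split; rewrite /t; lra.
have /eqP : (omega R - 1) * (omega R ^+ 2 + omega R + 1) = 0.
  rewrite -(subrr (omega R ^+ 3)) {2}w_cube; ring.
rewrite mulf_eq0 => /orP[|/eqP//]; rewrite /omega -/t.
by rewrite subr_eq0 eq_complex /= (gt_eqF sin_gt0) andbF.
Qed.

Lemma mirrors_root_like : all root_like (generators ++ mirrors).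
Proof. by vm_compute. Qed.

Lemma generators_permute : all permutes_mirrors generators.
Proof. by vm_compute. Qed.

Lemma mirrors_reachable : reachable generators mirrors.
Proof. by vm_compute. Qed.

Lemma mirrors_independent : pairwise independent mirrors.
Proof. by vm_compute. Qed.

Lemma mem_index_pairs i j : ((i, j) \in index_pairs) = (i < j < 6)%N.
Proof.
rewrite mem_filter; apply: andb_id2l => lt_ij.
apply/allpairsP/idP => [[[i' j'] [_ j_in [_ ->]]]|j_lt6].
  by move: j_in; rewrite mem_iota.
by exists (i, j); rewrite !mem_iota /= !add0n (ltn_trans lt_ij).
Qed.

Lemma perm_sort_roots l : perm_eq (sort_roots l) l.
Proof. by rewrite perm_sort. Qed.

(** * Invariants, the 126 reflections and the power sums *)

Section Invariance.

Variables (F : numClosedFieldType) (w : F).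
Hypothesis w_root : w ^+ 2 + w + 1 = 0.
Local Notation vec := (root_vec w).
Local Notation reflection := mirror_reflection.
Implicit Types (p : {mpoly F[6]}).

Lemma root_likeW b : b \in generators ++ mirrors -> root_like b.
Proof. by move=> b_in; have /allP := mirrors_root_like; apply. Qed.

Lemma root_like_size b : root_like b -> size b = 6.
Proof. by case/andP=> /eqP. Qed.

(* The reflection in c is the conjugate of the reflection in b by the reflection
   in a. *)
Lemma mpoly_act_reflects a b c p : root_like a -> root_like b -> reflects a b c ->
  mpoly_act (reflection (vec a)) p = p -> mpoly_act (reflection (vec c)) p = p ->
  mpoly_act (reflection (vec b)) p = p.
Proof.
move=> ra rb abc pa pc; have [u u6 cE] := reflectsP w_root ra (root_like_size rb) abc.
have nz_u : u != 0 by apply: contra_eq_neq u6 => ->; rewrite expr0n eq_sym oner_eq0.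
move: pc; rewrite cE (reflectionZ _ nz_u) reflection_conjugate -!mpoly_actM pa => pc.
have := congr1 (mpoly_act (reflection (vec a))) pc.
by rewrite mpoly_actM reflectionK mpoly_act1 pa.
Qed.

Lemma reachable_act known l p : all root_like (known ++ l) -> reachable known l ->
  {in known, forall a, mpoly_act (reflection (vec a)) p = p} ->
  {in l, forall b, mpoly_act (reflection (vec b)) p = p}.
Proof.
elim: l known => // b l IHl known; rewrite all_cat /= => /and3P[r_known rb rl].
case/andP=> /hasP[a a_known /andP[c_known abc]] reach_l p_known.
have pb : mpoly_act (reflection (vec b)) p = p.
  exact: (mpoly_act_reflects (allP r_known _ a_known) rb abc
    (p_known _ a_known) (p_known _ c_known)).
move=> d; rewrite inE => /predU1P[->//|d_l].
have r_known' : all root_like ((b :: known) ++ l) by rewrite /= all_cat rb r_known.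
apply: (IHl _ r_known' reach_l) d_l => a'.
by rewrite inE => /predU1P[->|/p_known].
Qed.

(** Only the generating reflections, not the group: being fixed by them already implies being fixed
    by all that they generate. *)
Definition mirror_group (g : 'M[F]_6) : Prop :=
  exists2 a, a \in generators & g = reflection (vec a).

Lemma invariant_mirrors p : G_invariant mirror_group p ->
  {in mirrors, forall b, mpoly_act (reflection (vec b)) p = p}.
Proof.
move=> p_inv; apply: reachable_act mirrors_root_like mirrors_reachable _ => a a_gen.
by apply: p_inv; exists a.
Qed.

Definition power_sum (d : nat) : {mpoly F[6]} :=
  \sum_(b <- mirrors) linear_form (vec b) ^+ d.

Lemma power_sum_invariant d : (6 %| d)%N -> G_invariant mirror_group (power_sum d).
Proof.
case/dvdnP=> k -> {d}; move=> _ [a a_gen ->].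
have /allP/(_ a a_gen)/andP[/eqP sortE /allP refl_a] := generators_permute.
have ra : root_like a by apply: root_likeW; rewrite mem_cat a_gen.
rewrite rmorph_sum /power_sum /=.
have perm_a : perm_eq [seq reflect_root a b | b <- mirrors] mirrors.
  apply: perm_trans (perm_sort_roots mirrors).
  by rewrite -sortE perm_sym perm_sort_roots.
rewrite -[RHS](perm_big _ perm_a) big_map; apply: eq_big_seq => b b_in.
have rb : root_like b by apply: root_likeW; rewrite mem_cat b_in orbT.
have [u u6 ->] := reflectsP w_root ra (root_like_size rb) (refl_a b b_in).
rewrite linear_formZ exprZn -mpoly_act_linear_form rmorphXn.
by rewrite mulnC [u ^+ _]exprM u6 expr1n scale1r.
Qed.

End Invariance.

(** * The Jacobian determinant of the power sums *)

Lemma mderiv_exp (R : comNzRingType) (n : nat) (p : {mpoly R[n]}) (d : nat) (j : 'I_n) :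
  (p ^+ d)^`M(j) = d%:R *: (p ^+ d.-1 * p^`M(j)).
Proof.
elim: d => [|d IHd]; first by rewrite expr0 -mpolyC1 mderivC scale0r.
rewrite exprS mderivM IHd /= -natr1 scalerDl scale1r addrC.
congr (_ + _); last exact: mulrC.
case: d {IHd} => [|d]; first by rewrite !scale0r mulr0.
by rewrite -scalerAr mulrA -exprS.
Qed.

Section Homogeneous.

Variables (F : fieldType) (n : nat).
Implicit Types (p : {mpoly F[n]}) (a : 'rV[F]_n).

Lemma linear_form_homog a : linear_form a \is 1.-homog.
Proof.
by apply: rpred_sum => i _; apply: rpredZ; rewrite dhomogX; apply/eqP/mdeg1.
Qed.

Lemma mderiv_linear_form a j : (linear_form a)^`M(j) = (a 0 j)%:MP.
Proof.
rewrite raddf_sum (bigD1 j) //= big1 => [|i neq_ij].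
  by rewrite addr0 mderivZ mderivXU eqxx -mul_mpolyC mulr1.
by rewrite mderivZ mderivXU (negPf neq_ij) scaler0.
Qed.

Lemma euler_homog p d : p \is d.-homog -> euler p = d%:R *: p.
Proof.
move=> p_homog; apply/mpolyP => m; rewrite mcoeff_euler mcoeffZ.
have [<- //|neq_md] := eqVneq (mdeg m) d.
by rewrite (dhomog_nemf_coeff p_homog neq_md) !mulr0.
Qed.

Lemma msize_homog p d : p \is d.-homog -> (msize p <= d.+1)%N.
Proof.
move/dhomogP => p_homog; rewrite msizeE big_tnth; apply/bigmax_leqP => /= j _.
by rewrite p_homog // mem_tnth.
Qed.

End Homogeneous.

Definition degrees : seq nat := [:: 1; 2; 3; 4; 5; 7]%N.

(* Up to a scalar on each row, the rows are the gradients at [point] of the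
   generators. *)
Definition gradient_values : seq (seq eis) := [seq gradient_value k | k <- degrees].

Definition gradient_entry (i j : nat) : Z :=
  (nth (0, 0)%BZ (nth [::] gradient_values i) j).1.

(* The inverse modulo 29 of the matrix [gradient_entry]. *)
Definition inverse_mod29 : seq (seq Z) :=
  [:: [:: 18; 25; 8; 3; 7; 28];
     [:: 10; 25; 5; 16; 13; 0];
     [:: 22; 19; 8; 5; 21; 21];
     [:: 15; 14; 12; 13; 17; 20];
     [:: 13; 14; 28; 22; 27; 14];
     [:: 23; 1; 10; 13; 26; 2]]%BZ.

Definition certificate_entry (i j : nat) : Z :=
  nth 0%BZ (nth [::] inverse_mod29 i) j.

Definition product_entry (i j : nat) : Z :=
  foldr (fun k s => certificate_entry i k * gradient_entry k j + s)%BZ 0%BZ (iota 0 6).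

(** Conjugation permutes the forms up to sign, the point is real, and each term has even total
    degree 6k in its form, so the sums are real. *)
Lemma gradient_values_real :
  all (all (fun x => x.2 == 0%BZ)) gradient_values.
Proof. by vm_compute. Qed.

Lemma certificate_product :
  all (fun i => all (fun j =>
    (product_entry i j mod 29)%BZ == Z.of_nat (i == j)) (iota 0 6)) (iota 0 6).
Proof. by vm_compute. Qed.

Lemma int_of_Z_product i j : int_of_Z (product_entry i j) =
  \sum_(k < 6) int_of_Z (certificate_entry i k) * int_of_Z (gradient_entry k j).
Proof.
rewrite -(big_mkord xpredT (fun k => int_of_Z (certificate_entry i k) *
  int_of_Z (gradient_entry k j))) /product_entry /index_iota subn0.
elim: (iota 0 6) => [|k s IHs] /=; first by rewrite big_nil.
rewrite big_cons -IHs.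
by rewrite (rmorphD int_of_Z (_ * _)%BZ) (rmorphM int_of_Z (certificate_entry i k)).
Qed.

(** An inverse modulo 29 shows that the determinant is not divisible by 29. It replaces the
    expansion of a determinant whose entries involve 41st powers by a matrix product. *)
Lemma gradient_det_neq0 :
  \det (\matrix_(i < 6, j < 6) int_of_Z (gradient_entry i j)) != 0.
Proof.
set A := \matrix_(i, j) _.
pose B := \matrix_(i < 6, j < 6) int_of_Z (certificate_entry i j).
have BA1 : map_mx (intr : int -> 'F_29) (B *m A) = 1%:M.
  apply/matrixP => i j; rewrite !mxE.
  under eq_bigr do rewrite !mxE.
  rewrite -int_of_Z_product.
  have := certificate_product => /allP/(_ (i : nat)).
  rewrite mem_iota ltn_ord => /(_ isT)/allP/(_ (j : nat)).
  rewrite mem_iota ltn_ord => /(_ isT)/eqP modE.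
  rewrite (Z.div_mod (product_entry i j) 29) // modE.
  rewrite (rmorphD int_of_Z (_ * _)%BZ) (rmorphM int_of_Z 29%BZ).
  rewrite rmorphD rmorphM /= (_ : (29%:Z)%:~R = 0 :> 'F_29); last exact/val_inj.
  by rewrite mul0r add0r -val_eqE; case: (\val i == \val j).
apply: contraTneq isT => A0; have := congr1 determinant BA1.
rewrite map_mxM det_mulmx !det_map_mx A0 rmorph0 mulr0 det1 => /eqP.
by rewrite eq_sym oner_eq0.
Qed.

Section JacobianPowerSums.

Variables (F : numClosedFieldType) (w : F).
Hypothesis w_root : w ^+ 2 + w + 1 = 0.
Local Notation vec := (root_vec w).

Lemma power_sum_homog d : power_sum w d \is d.-homog.
Proof.
apply: rpred_sum => b _.
by have := dhomogMn d (linear_form_homog (vec b)); rewrite mul1n.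
Qed.

Definition invariants (i : 'I_6) : {mpoly F[6]} :=
  81%:R^-1 *: power_sum w (6 * nth 0%N degrees i).

Definition point_val (i : 'I_6) : F := eis_val w (nth (0, 0)%BZ point i).

Lemma size_mirror b : b \in mirrors -> size b = 6.
Proof.
by move=> b_in; apply: root_like_size; apply: root_likeW; rewrite mem_cat b_in orbT.
Qed.

Lemma meval_linear_form b : size b = 6 ->
  (linear_form (vec b)).@[point_val] = eis_val w (eis_dot b point).
Proof.
move=> sb; rewrite (eis_val_sum w) big_map sum_zip6 // raddf_sum.
by apply: eq_bigr => i _; rewrite /= mevalZ mevalXU mxE eis_valM.
Qed.

Lemma meval_gradient k (j : 'I_6) : (power_sum w (6 * k))^`M(j).@[point_val] =
  (6 * k)%:R * eis_val w (nth (0, 0)%BZ (gradient_value k) j).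
Proof.
rewrite (nth_map 0%N) ?size_iota // nth_iota // add0n eis_val_sum !big_map.
rewrite /power_sum (raddf_sum (mderiv j)) (raddf_sum (meval point_val)) mulr_sumr.
apply: eq_big_seq => b b_in /=.
rewrite mderiv_exp mevalZ mevalM mderiv_linear_form mevalC mxE eis_valM //.
by rewrite eis_val_exp // rmorphXn /= meval_linear_form // size_mirror.
Qed.

Lemma jacobian_invariants_neq0 : jacobian invariants != 0.
Proof.
pose A := \matrix_(i < 6, j < 6) int_of_Z (gradient_entry i j).
(* The scalars relating the rows: 6k is the exponent omitted by [gradient_value], and 1/81 the
   normalization of [invariants]. *)
pose c := \row_(i < 6) (81%:R^-1 * (6 * nth 0%N degrees i)%:R : F).
have evalE : map_mx (meval point_val) (jacobian_mx invariants) =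
    diag_mx c *m map_mx intr A.
  apply/matrixP => i j; rewrite mul_diag_mx !mxE mderivZ mevalZ meval_gradient.
  rewrite -mulrA; congr (_ * (_ * _)).
  have -> : gradient_value (nth 0%N degrees i) = nth [::] gradient_values i.
    by rewrite (nth_map 0%N).
  have size_i : (i < size gradient_values)%N by rewrite size_map.
  have size_j : (j < size (nth [::] gradient_values i))%N.
    by rewrite (nth_map 0%N) // size_map size_iota.
  have /(all_nthP [::])/(_ i size_i) := gradient_values_real.
  move=> /(all_nthP (0, 0)%BZ)/(_ j size_j)/eqP im0.
  by rewrite /eis_val im0 mul0r addr0.
have : (jacobian invariants).@[point_val] != 0.
  rewrite /jacobian -det_map_mx evalE det_mulmx det_diag mulf_neq0 //.
    apply/prodf_neq0 => i _; rewrite mxE mulf_neq0 ?invr_eq0 ?pnatr_eq0 //.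
    by case: i => [[|[|[|[|[|[|]]]]]]].
  by rewrite det_map_mx intr_eq0 gradient_det_neq0.
by apply: contraNneq => ->; rewrite meval0.
Qed.

Theorem mirror_group_invariants :
  polynomial_algebra_on (G_invariant (mirror_group w)) [tuple invariants i | i < 6].
Proof.
pose e (i : 'I_6) := (6 * nth 0%N degrees i)%N.
have rlike b : b \in mirrors -> root_like b.
  by move=> b_in; apply: root_likeW; rewrite mem_cat b_in orbT.
have inv_homog i : invariants i \is (e i).-homog.
  by apply: rpredZ; apply: power_sum_homog.
apply: (@jacobian_criterion _ _ _ invariants e
  (fun a => (map_mx Num.conj a)^T) (map vec mirrors)).
- exact: pchar_num.
- move=> i g Gg; rewrite mpoly_actZ power_sum_invariant //.
  exact: dvdn_mulr.
- by move=> i; apply: euler_homog.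
- by move=> i; apply: msize_homog.
- by case=> [[|[|[|[|[|[|]]]]]]].
- move=> _ /mapP[b /rlike b_like ->].
  by rewrite (root_like_norm w_root) // pnatr_eq0.
- rewrite pairwise_map; apply: sub_pairwise mirrors_independent => a b.
  exact: independentP.
- move=> _ /mapP[b b_in ->].
  exists (2 / (vec b *m (map_mx Num.conj (vec b))^T) 0 0); last first.
    by move=> p p_inv; apply: invariant_mirrors.
  by rewrite (root_like_norm w_root) ?rlike // mulf_neq0 ?invr_eq0 ?pnatr_eq0.
(* Both sides are 126: 45 + 81 mirrors, and 5 + 11 + 17 + 23 + 29 + 41. *)
- by rewrite size_map !big_ord_recl big_ord0.
- exact: jacobian_invariants_neq0.
Qed.

End JacobianPowerSums.

(** * The generators as power sums *)

(** The truncated division is exact: by induction, x! times the factorials of the other parts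
    divides (x + sumn e)!, through the binomial coefficient. *)
Lemma multinomial_coefE e : (multinomial_coef e * \prod_(x <- e) x`!)%N = (sumn e)`!.
Proof.
rewrite /multinomial_coef divnK //; elim: e => [|x e IHe] /=.
  by rewrite big_nil.
rewrite big_cons -(bin_fact (leq_addr (sumn e) x)) addKn dvdn_mull //.
exact: dvdn_mul.
Qed.

Lemma perm_multinomial_coef e e' : perm_eq e e' ->
  multinomial_coef e = multinomial_coef e'.
Proof.
by move=> ee'; rewrite /multinomial_coef (perm_big _ ee') (perm_sumn ee').
Qed.

Lemma multinomial_coef_pad e k :
  multinomial_coef (e ++ nseq k 0%N) = multinomial_coef e.
Proof.
rewrite /multinomial_coef sumn_cat sumn_nseq mul0n addn0 big_cat /=.
by rewrite [X in (_ * X)%N]big1_seq ?muln1 // => x /andP[_ /nseqP[->]].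
Qed.

Lemma multinomial_coef2 x y : multinomial_coef [:: x; y] = 'C(x + y, y).
Proof.
have := multinomial_coefE [:: x; y].
rewrite !big_cons big_nil /= muln1 addn0 [(x`! * _)%N]mulnC.
rewrite -[RHS](bin_fact (leq_addl x y)) addnK => /eqP.
by rewrite eqn_pmul2r ?muln_gt0 ?fact_gt0 // => /eqP.
Qed.

Lemma mdeg_sumn (n : nat) (m : 'X_{1..n}) : mdeg m = sumn m.
Proof. by rewrite mdegE sumnE big_tuple. Qed.

(** The multinomial theorem, multiplied by the factorials of the exponents and proved by induction
    on [d]: differentiating in a variable of [m] relates the coefficient at [m] to that of the next
    lower power at [m - U_(i)]. *)
Lemma mcoeff_linear_form_exp (F : numFieldType) (n : nat) (a : 'rV[F]_n) d
    (m : 'X_{1..n}) : mdeg m = d ->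
  (linear_form a ^+ d)@_m =
    (multinomial_coef m)%:R * \prod_i a 0 i ^+ m i.
Proof.
move=> deg_m; pose fact_m := \prod_(i < n) (m i)`!%:R : F.
have fact_mE : fact_m = (\prod_(x <- m) x`!)%:R.
  by rewrite (big_tuple _ _ (multinom_val m)) natr_prod.
have nz_fact : fact_m != 0.
  by apply/prodf_neq0 => i _; rewrite pnatr_eq0 -lt0n fact_gt0.
apply: (mulIf nz_fact); rewrite mulrAC [in RHS]fact_mE -natrM multinomial_coefE.
have -> : sumn m = d by rewrite -deg_m mdeg_sumn.
clear nz_fact fact_mE; rewrite {}/fact_m.
elim: d m deg_m => [|d IHd] m deg_m.
  have -> : m = 0%MM by apply/eqP; rewrite -mdeg_eq0 deg_m.
  rewrite expr0 mcoeff1 eqxx !mul1r.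
  by rewrite !big1 // => i _; rewrite mnm0E.
have [i m_gt0] : exists i, (0 < m i)%N.
  apply/existsP; apply: contra_eqT deg_m => /existsPn m0.
  by rewrite mdegE big1 // => i _; apply/eqP; rewrite -leqn0 leqNgt.
pose m' := (m - U_(i))%MM.
have mE : m = (m' + U_(i))%MM by rewrite submK ?lep1mP -?lt0n.
have deg_m' : mdeg m' = d by apply/eqP; rewrite -eqSS -deg_m mE mdegD mdeg1 addn1.
have m'i : m i = (m' i).+1 by rewrite mE mnmDE mnm1E eqxx addn1.
have m'j j : j != i -> m j = m' j.
  by move=> neq_ji; rewrite mE mnmDE mnm1E eq_sym (negPf neq_ji) addn0.
have := congr1 (mcoeff m') (mderiv_exp (linear_form a) d.+1 i).
rewrite mcoeff_deriv -mE mderiv_linear_form mulrC mul_mpolyC !mcoeffZ => dE.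
rewrite (bigD1 i) //= [in RHS](bigD1 i) //= m'i.
rewrite (eq_bigr (fun j => (m' j)`!%:R)) => [|j /m'j->//].
rewrite [in RHS](eq_bigr (fun j => a 0 j ^+ m' j)) => [|j /m'j->//].
have := IHd m' deg_m'; rewrite (bigD1 i) //= [in RHS](bigD1 i) //=.
set P := \prod_(j | _) (_)%:R; set Q := \prod_(j | _) _ => IH.
transitivity ((linear_form a ^+ d.+1)@_m *+ (m' i).+1 * ((m' i)`!%:R * P)).
  by rewrite -mulr_natr factS natrM; ring.
rewrite dE; transitivity (d.+1%:R * a 0 i *
  ((linear_form a ^+ d)@_m' * ((m' i)`!%:R * P))); first by rewrite /=; ring.
by rewrite IH factS natrM [a 0 i ^+ _.+1]exprS; ring.
Qed.

Lemma mcoeff_monomial_sym (F : fieldType) (n : nat) e (m : 'X_{1..n}) :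
  (size e <= n)%N ->
  (monomial_sym F n e)@_m = (perm_eq m (e ++ nseq (n - size e) 0%N))%:R.
Proof.
move=> le_en; rewrite -mem_permutations.
rewrite -(count_uniq_mem _ (permutations_uniq _)) -sum1_count natr_sum raddf_sum.
rewrite [RHS]big_mkcond; apply: eq_big_seq => t.
rewrite mem_permutations => /perm_size; rewrite size_cat size_nseq subnKC // => size_t.
rewrite /= mcoeffX.
have -> : ([multinom nth 0%N t i | i < n] == m) = (t == m :> seq nat).
  apply/eqP/eqP => [<-|->]; last first.
    by apply/mnmP => i; rewrite mnmE; apply/esym/tnth_nth.
  apply: (@eq_from_nth _ 0%N) => [|k lt_kt]; first by rewrite size_tuple.
  rewrite size_t in lt_kt.
  by rewrite -[k]/(val (Ordinal lt_kt)) nth_mktuple.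
by rewrite /= eq_sym; case: eqP.
Qed.

Arguments words : simpl never.

(** * Coefficients of the power sums: words and pairs *)

Section F6.

Variables (F : numClosedFieldType) (w : F).
Hypothesis w_root : w ^+ 2 + w + 1 = 0.
Local Notation vec := (root_vec w).

Lemma cube_root_sum n : 1 + w ^+ n + (w ^+ n) ^+ 2 = ((3 %| n) * 3)%:R.
Proof.
have w3k k : w ^+ (k * 3) = 1 by rewrite mulnC exprM w_cube // expr1n.
rewrite {1 2}(divn_eq n 3) exprD w3k mul1r /dvdn.
have := ltn_pmod n (isT : 0 < 3)%N; case: (n %% 3)%N => [|[|[|]]] // _.
- by rewrite expr0 expr1n mul1n; ring.
- by apply: etrans w_root; ring.
- by apply: etrans w_root; rewrite -exprM (exprD w 3 1) w_cube // mul1r; ring.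
Qed.

(** Expanding the product, the letters of a word select 1, x or x^2 from the successive factors. *)
Lemma sum_words (xs : seq F) :
  \sum_(v <- words (size xs)) \prod_(p <- zip xs v) p.1 ^+ p.2 =
  \prod_(x <- xs) (1 + x + x ^+ 2).
Proof.
elim: xs => [|x xs IHxs]; first by rewrite /= big_seq1 !big_nil.
rewrite [RHS]big_cons -IHxs big_allpairs_dep /= !big_cons big_nil addr0.
rewrite !mulrDl mul1r -addrA !mulr_sumr.
by congr (_ + (_ + _)); apply: eq_bigr => v _; rewrite big_cons ?expr0 ?mul1r.
Qed.

Lemma mem_words n v : (v \in words n) = (size v == n) && all (gtn 3) v.
Proof.
elim: n v => [|n IHn] v; first by case: v.
apply/allpairsP/idP => [[[c u] [c_in u_in ->]]|].
  move: u_in; rewrite IHn => /= /andP[/eqP-> ->].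
  by move: c_in; rewrite mem_iota eqxx andbT.
case: v => [|c u] //=; rewrite eqSS => /andP[size_u /andP[c_lt3 u_lt3]].
by exists (c, u); split=> //=; [case: c c_lt3 => [|[|[]]] | rewrite IHn size_u].
Qed.

Lemma twist_words ms v t : size ms = size v ->
  \prod_(p <- zip [seq w ^+ (x + t) | x <- ms] v) p.1 ^+ p.2 =
  \prod_(p <- zip [seq w ^+ x | x <- ms] v) p.1 ^+ p.2 * (w ^+ sumn v) ^+ t.
Proof.
elim: ms v => [|x ms IHms] [|c v] //=; first by rewrite !big_nil expr1n mulr1.
case=> /IHms IH; rewrite !big_cons /= IH exprD exprMn exprD exprMn -!exprM.
rewrite [(t * c)%N]mulnC; ring.
Qed.

(* The condition on the letters is detected by a sum over the characters of
   Z/3, after which the sum over all words factors. *)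
Lemma sum_balanced_words ms :
  3%:R * \sum_(v <- words (size ms) | (3 %| sumn v)%N)
           \prod_(p <- zip [seq w ^+ x | x <- ms] v) p.1 ^+ p.2 =
  (3 ^ size ms * \sum_(t < 3) all (fun x => 3 %| x + t)%N ms)%:R.
Proof.
rewrite natrM natr_sum [RHS]mulr_sumr [LHS]mulr_sumr.
transitivity (\sum_(t < 3) \sum_(v <- words (size ms))
    \prod_(p <- zip [seq w ^+ (x + t) | x <- ms] v) p.1 ^+ p.2).
  rewrite exchange_big [LHS]big_mkcond; apply: eq_big_seq => v.
  rewrite mem_words => /andP[/eqP size_v _].
  under [RHS]eq_bigr => t _ do rewrite twist_words //.
  rewrite -mulr_sumr !big_ord_recl big_ord0 /= addr0 expr0 expr1 addrA cube_root_sum.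
  by case: (3 %| sumn v)%N; rewrite ?mulr0 // mul1n mulrC.
apply: eq_bigr => t _.
have := sum_words [seq w ^+ (x + t) | x <- ms]; rewrite size_map => ->.
rewrite big_map; elim: ms => [|x ms IHms] /=.
  by rewrite big_nil expn0 mulr1.
rewrite big_cons IHms cube_root_sum.
by case: (3 %| _)%N; rewrite ?mul0r ?mulr0 // mul1n expnS natrM mulrA.
Qed.

(** The sum is 1 if the five entries of [ms] share a residue x mod 3, and 0 otherwise. In the first
    case m = -5 x = x mod 3, so the exponent of the first variable is congruent to them as well. *)
Lemma balanced_residues m ms : (3 %| m + sumn ms)%N -> size ms = 5 ->
  (\sum_(t < 3) all (fun x => 3 %| x + t)%N ms)%N = congruent_parts (m :: ms).
Proof.
move=> dvd_m size_ms.
(* Both sides depend only on residues mod 3, so it suffices to run through the 3^6 residue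
   vectors. *)
have check : all (fun v => (3 %| sumn v)%N ==>
    ((\sum_(t <- iota 0 3) all (fun x => 3 %| x + t)%N (behead v))%N
      == congruent_parts v)) (words 6).
  by rewrite unlock; vm_compute.
have mod_in : [seq x %% 3 | x <- m :: ms]%N \in words 6.
  rewrite mem_words size_map /= size_ms eqxx /= ltn_mod all_map.
  by apply/andP; split=> //; apply/allP => x _ /=; rewrite ltn_mod.
have mod_sum l : sumn [seq x %% 3 | x <- l]%N = sumn l %[mod 3].
  by elim: l => //= x l IHl; rewrite modnDml -modnDmr IHl modnDmr.
have := allP check _ mod_in; rewrite /dvdn mod_sum -/(dvdn _ _) dvd_m => /eqP modE.
rewrite -(big_mkord xpredT (fun t => all (fun x => 3 %| x + t)%N ms : nat)).
rewrite /index_iota subn0.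
transitivity (\sum_(t <- iota 0 3)
    all (fun x => 3 %| x + t)%N [seq x %% 3 | x <- ms]%N)%N.
  apply: eq_bigr => t _; rewrite all_map; congr (nat_of_bool _).
  by apply: eq_all => x /=; rewrite /dvdn modnDml.
rewrite {}modE; congr (nat_of_bool _).
rewrite /congruent_parts allrel_mapl allrel_mapr.
by apply: eq_allrel => x y; rewrite /= !modn_mod.
Qed.

Lemma word_roots_coeff (m : 'X_{1..6}) : (3 %| mdeg m)%N ->
  \sum_(b <- word_roots) \prod_i vec b 0 i ^+ m i = (81 * congruent_parts m)%:R.
Proof.
move=> dvd_m; have [ms [size_ms mE m_lift]] : exists ms : seq nat, [/\ size ms = 5,
    m = m ord0 :: ms :> seq nat & forall i : 'I_5, m (lift ord0 i) = nth 0%N ms i].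
  exists (behead m); split=> [||i]; first by rewrite size_behead size_tuple.
    apply: (@eq_from_nth _ 0%N) => [|[|l] _] /=; rewrite ?nth_behead //.
      by rewrite size_behead size_tuple.
    exact/esym/tnth_nth.
  by rewrite nth_behead; apply: tnth_nth.
have dvd_sum : (3 %| m ord0 + sumn ms)%N.
  by rewrite -[(_ + _)%N]/(sumn (m ord0 :: ms)) -mE -mdeg_sumn.
have nz3 : 3%:R != 0 :> F by rewrite pnatr_eq0.
apply: (mulfI nz3); rewrite -natrM mE -balanced_residues // mulnA.
(* Five letters are free, since the first is 0, and the extra 3 is the number of characters of
   Z/3. *)
have -> : (3 * 81)%N = (3 ^ size ms)%N by rewrite size_ms.
rewrite -sum_balanced_words size_ms big_map big_filter; congr (_ * _).
rewrite [LHS]big_seq_cond [RHS]big_seq_cond; apply: eq_bigr => v.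
rewrite mem_words => /andP[/andP[/eqP size_v v_lt3] _].
rewrite big_ord_recl mxE /= eis_val1 expr1n mul1r.
rewrite (big_nth (0, 0%N)) size_zip size_map size_ms size_v big_mkord.
apply: eq_bigr => i _; rewrite m_lift mxE nth_zip ?size_map ?size_ms //=.
rewrite add0n /word_root !(nth_map 0%N) ?size_v ?size_ms // eis_val_omega_pow //.
  by rewrite -!exprM mulnC.
by apply: (allP v_lt3); rewrite mem_nth ?size_v.
Qed.

Definition support (m : seq nat) : seq nat := [seq l <- iota 0 6 | nth 0 m l != 0]%N.

(** One third of the sum of (- w^c)^y over c < 3: the contribution of the coefficient of x_j in x_i
    - w^c x_j. *)
Definition pair_sign (y : nat) : F := (3 %| y)%N%:R * (-1) ^+ y.

Lemma theta_sqr : eis_val w theta ^+ 2 = - 3%:R.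
Proof.
rewrite /eis_val /theta /= (_ : Zr F 2 = 2%:R) // (_ : Zr F 1 = 1) //.
transitivity (- 3%:R + 4%:R * (w ^+ 2 + w + 1)); first ring.
by rewrite w_root mulr0 addr0.
Qed.

Lemma pair_entry (i j : 'I_6) c l : (c < 3)%N ->
  vec (pair_root i j c) 0 l =
  if l == i then eis_val w theta
  else if l == j then - (eis_val w theta * w ^+ c) else 0.
Proof.
move=> c_lt3; rewrite mxE (nth_map 0%N) ?size_iota // nth_iota // add0n.
rewrite !(inj_eq val_inj); case: eqP => // _; case: eqP => _; last exact: eis_val0.
by rewrite eis_valN eis_valM // eis_val_omega_pow.
Qed.

(** A variable other than x_i and x_j has coefficient 0 in these forms and kills the product.
    Otherwise theta occurs to the power 6k, giving (-3)^(3k) = (-27)^k, and the sum over [c] is a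
    sum over cube roots of unity. *)
Lemma pair_roots_coeff (m : 'X_{1..6}) k (i j : 'I_6) : mdeg m = (6 * k)%N -> i != j ->
  \sum_(c <- iota 0 3) \prod_l vec (pair_root i j c) 0 l ^+ m l =
  3%:R * (- 27%:R) ^+ k *
    ((all (pred2 (i : nat) (j : nat)) (support m))%:R * pair_sign (m j)).
Proof.
move=> deg_m neq_ij; have neq_ji : j != i by rewrite eq_sym.
have [supp_m|/allPn[l]] := boolP (all _ _); last first.
  rewrite mem_filter mem_iota add0n => /andP[nz_ml /andP[_ l_lt6]].
  rewrite negb_or => /andP[neq_li neq_lj].
  rewrite mul0r mulr0 big1_seq // => c /andP[_]; rewrite mem_iota => /andP[_ c_lt3].
  rewrite (bigD1 (Ordinal l_lt6)) //= pair_entry // -!val_eqE /=.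
  rewrite (negPf neq_li) (negPf neq_lj) expr0n.
  have -> : (m (Ordinal l_lt6) == 0%N) = false.
    by rewrite -[m _]/(tnth _ _) (tnth_nth 0%N) (negPf nz_ml).
  by rewrite mul0r.
have m0 l : l != i -> l != j -> m l = 0%N.
  move=> neq_li neq_lj; apply/eqP; apply: contraT => nz_ml.
  have /(allP supp_m) : (l : nat) \in support m.
    by rewrite mem_filter mem_iota ltn_ord !andbT -tnth_nth.
  by rewrite /= !(inj_eq val_inj) (negPf neq_li) (negPf neq_lj).
have sum_ij : (m i + m j = 6 * k)%N.
  rewrite -deg_m mdegE (bigD1 i) //= (bigD1 j) //= big1 ?addn0 //.
  by move=> l /andP[]; apply: m0.
rewrite mul1r (eq_big_seq (fun c => (- 27%:R) ^+ k * (-1) ^+ m j * (w ^+ m j) ^+ c)).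
  rewrite -mulr_sumr !big_cons big_nil addr0 expr0 expr1 addrA cube_root_sum.
  by rewrite /pair_sign natrM; ring.
move=> c; rewrite mem_iota add0n => /andP[_ c_lt3].
rewrite (bigD1 i) //= (bigD1 j) //= big1 => [|l /andP[neq_li neq_lj]]; last first.
  by rewrite m0 // expr0.
rewrite mulr1 !pair_entry // !eqxx (negPf neq_ji).
rewrite [(- (_ * _)) ^+ _]exprNn exprMn -!exprM [(c * _)%N]mulnC.
transitivity (eis_val w theta ^+ (m i + m j) * (-1) ^+ m j * w ^+ (m j * c)).
  by rewrite exprD; ring.
rewrite sum_ij (exprM _ 6 k) (exprM _ 2 3) theta_sqr.
by rewrite (_ : (- 3%:R) ^+ 3 = - 27%:R :> F) //; ring.
Qed.

Lemma mcoeff_power_sum (m : 'X_{1..6}) k : mdeg m = (6 * k)%N ->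
  (power_sum w (6 * k))@_m = (multinomial_coef m)%:R *
   (3%:R * (- 27%:R) ^+ k * (\sum_(p <- index_pairs)
      (all (pred2 p.1 p.2) (support m))%:R * pair_sign (nth 0%N m p.2))
    + (81 * congruent_parts m)%:R).
Proof.
move=> deg_m; rewrite /power_sum (raddf_sum (mcoeff m)).
rewrite (eq_bigr (fun b => (multinomial_coef m)%:R * \prod_i vec b 0 i ^+ m i));
  last by move=> b _; apply: mcoeff_linear_form_exp.
rewrite -mulr_sumr big_cat; congr (_ * (_ + _)); last first.
  by apply: word_roots_coeff; rewrite deg_m -(mulnA 3 2 k) dvdn_mulr.
rewrite big_allpairs_dep /= mulr_sumr; apply: eq_big_seq => -[i j].
rewrite mem_index_pairs => /andP[lt_ij j_lt6].
have i_lt6 := ltn_trans lt_ij j_lt6.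
have := @pair_roots_coeff m k (Ordinal i_lt6) (Ordinal j_lt6) deg_m.
rewrite -val_eqE /= ltn_eqF // => -> //.
by rewrite -[m (Ordinal j_lt6)]/(tnth _ _) (tnth_nth 0%N).
Qed.

(** Only the pattern of zeros of [m] matters, which leaves 2^6 cases. The 5 here becomes the 5 in
    the coefficient of m_(6k). *)
Lemma pairs_of_support m :
  let ps := [seq p <- index_pairs | all (pred2 p.1 p.2) (support m)] in
  match support m with
  | [::] => True
  | [:: u] => size ps = 5
  | [:: u; v] => ps = [:: (u, v)]
  | _ => ps = [::]
  end.
Proof.
rewrite /support filter_mask.
have := size_map (fun l => nth 0%N m l != 0%N) (iota 0 6).
move: (map _ _) => [|b0 [|b1 [|b2 [|b3 [|b4 [|b5 [|b6 bs]]]]]]] // _.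
by case: b0; case: b1; case: b2; case: b3; case: b4; case: b5.
Qed.

(** Since 6 divides x + y, the two numbers have the same parity and are divisible by 3 together.
    Thus it does not matter which exponent of a monomial in two variables is taken as y. *)
Lemma pair_sign_sym x y k : (x + y = 6 * k)%N -> pair_sign x = pair_sign y.
Proof.
move=> xy; rewrite /pair_sign -[(-1) ^+ x]signr_odd -[(-1) ^+ y]signr_odd.
by congr (_%:R * (-1) ^+ _); congr nat_of_bool; lia.
Qed.

Lemma sum_support m k : size m = 6 -> sumn m = (6 * k)%N -> support m != [::] ->
  \sum_(p <- index_pairs)
    (all (pred2 p.1 p.2) (support m))%:R * pair_sign (nth 0%N m p.2) =
  match [seq nth 0%N m l | l <- support m] with
  | [:: x] => 5%:R
  | [:: x; y] => pair_sign y
  | _ => 0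
  end.
Proof.
move=> size_m sum_m nz_m.
have -> : \sum_(p <- index_pairs)
    (all (pred2 p.1 p.2) (support m))%:R * pair_sign (nth 0%N m p.2) =
    \sum_(p <- [seq p <- index_pairs | all (pred2 p.1 p.2) (support m)])
      pair_sign (nth 0%N m p.2).
  rewrite [RHS]big_filter [RHS]big_mkcond; apply: eq_bigr => p _.
  by case: (all _ _); rewrite ?mul1r ?mul0r.
have := pairs_of_support m; cbv zeta; set ps := filter _ _; clearbody ps.
case support_m: (support m) nz_m => [|u [|v [|x s]]] //= _.
- move=> size_ps; rewrite (eq_bigr (fun=> 1)) => [|p _].
    by rewrite big_const_seq count_predT size_ps iter_addr_0.
  have m0 l : l != u -> nth 0%N m l = 0%N.
    move=> neq_lu; have [le_6l|lt_l6] := leqP 6 l; first by rewrite nth_default ?size_m.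
    apply: contraNeq neq_lu => nz_ml.
    have : l \in support m by rewrite mem_filter nz_ml mem_iota.
    by rewrite support_m inE.
  (* Whether the second index of the pair is [u] or not, the exponent there is 6k or 0, and
     [pair_sign] is 1 at both. *)
  have [p2u|/m0 ->] := eqVneq p.2 u; last by rewrite /pair_sign mul1r.
  have u_lt6 : (u < 6)%N.
    have : u \in support m by rewrite support_m mem_head.
    by rewrite mem_filter mem_iota => /and3P[].
  have -> : nth 0%N m p.2 = (6 * k)%N.
    rewrite -sum_m p2u sumnE (big_nth 0%N) size_m big_mkord.
    by rewrite (bigD1 (Ordinal u_lt6)) //= big1 ?addn0 // => l /m0.
  rewrite /pair_sign -(mulnA 3 2 k) dvdn_mulr // mul1r -signr_odd.
  by rewrite mulnCA oddM.
- by move=> ->; rewrite big_seq1.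
- by move=> ->; rewrite big_nil.
Qed.

End F6.

(** * Exponent vectors as padded partitions, and the coefficients of f_6k *)

Lemma padded_partition (m : seq nat) n : size m = n -> exists e,
  [/\ is_partition (sumn m) e, (size e <= n)%N &
      perm_eq m (e ++ nseq (n - size e) 0%N)].
Proof.
move=> size_m; exists (sort geq [seq x <- m | x != 0]%N).
have perm_m : perm_eq m (sort geq [seq x <- m | x != 0%N] ++ [seq x <- m | x == 0%N]).
  rewrite -(perm_filterC (fun x => x != 0%N)) perm_cat ?perm_sort //.
    by rewrite perm_sym perm_sort.
  by rewrite (eq_filter (a2 := pred1 0%N)) // => x; rewrite /= negbK.
have zeros : [seq x <- m | x == 0%N] = nseq (size [seq x <- m | x == 0%N]) 0%N.
  by apply/all_pred1P; apply: filter_all.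
have := perm_size perm_m; rewrite size_cat size_m => nE.
rewrite nE addKn -zeros leq_addr; split=> //.
rewrite /is_partition sort_sorted /=; last by move=> x y; apply: leq_total.
rewrite mem_sort mem_filter eqxx /= (perm_sumn perm_m) sumn_cat zeros sumn_nseq.
by rewrite mul0n addn0.
Qed.

Lemma perm_padded (e e' : seq nat) n n' k k' : is_partition n e -> is_partition n' e' ->
  perm_eq (e ++ nseq k 0%N) (e' ++ nseq k' 0%N) -> e = e'.
Proof.
have nzK d j l : is_partition d l -> [seq x <- l ++ nseq j 0%N | x != 0%N] = l.
  case/and3P=> _ l0 _; rewrite filter_cat [X in _ ++ X](_ : _ = [::]).
    rewrite cats0; apply/all_filterP/allP => x x_l.
    by apply: contraNneq l0 => <-.
  by apply/eqP; rewrite -size_eq0 size_filter count_nseq.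
move=> pe pe' /(perm_filter (fun x => x != 0%N)).
rewrite (nzK _ _ _ pe) (nzK _ _ _ pe').
have [/and3P[sort_e _ _] /and3P[sort_e' _ _]] := (pe, pe').
have geq_tr : transitive geq by move=> y x z xy yz; apply: leq_trans yz xy.
have geq_anti : antisymmetric geq by move=> x y xy; apply: anti_leq; rewrite andbC.
exact: sorted_eq geq_tr geq_anti _ _ sort_e sort_e'.
Qed.

(** The expression of [f6] over an arbitrary field, so that the comparison with the power sums can
    be made abstractly; at [R[i]] it is [f6] by conversion. *)
Definition f6_of (F : fieldType) (k : nat) : {mpoly F[6]} :=
  (1 + (-1) ^+ k * 27 ^+ k.-1 * 5) *: monomial_sym F 6 [:: 6 * k]%N
  + \sum_(1 <= s < k.+1)
      ('C(6 * k, 3 * s)%:R * (1 + (-1) ^+ (k + s) * 27 ^+ k.-1))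
        *: monomial_sym F 6 [:: 6 * k - 3 * s; 3 * s]%N
  + \sum_(3 <= r < 7)
      \sum_(t : r.-tuple 'I_(6 * k).+1 |
              let e := map val t in
              [&& is_partition (6 * k) e, congruent_parts e
                & (r < 6)%N ==> all (fun x => 3 %| x)%N e])
        (multinomial_coef (map val t))%:R *: monomial_sym F 6 (map val t).

Lemma monomial_sym_homog (F : fieldType) n e d : (size e <= n)%N -> sumn e = d ->
  monomial_sym F n e \is d.-homog.
Proof.
move=> le_en <-; apply/dhomogP => m; rewrite mcoeff_msupp mcoeff_monomial_sym //.
case: (boolP (perm_eq _ _)); last by rewrite eqxx.
move=> /perm_sumn; rewrite sumn_cat sumn_nseq mul0n addn0 => <- _.
exact: mdeg_sumn.
Qed.

Lemma f6_of_homog (F : fieldType) k : f6_of F k \is (6 * k).-homog.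
Proof.
rewrite !rpredD ?rpredZ ?monomial_sym_homog //=; first by rewrite addn0.
  rewrite big_seq_cond rpred_sum // => s; rewrite andbT mem_index_iota ltnS.
  move=> /andP[_ le_sk]; rewrite rpredZ ?monomial_sym_homog //= addn0 subnK //.
  by rewrite leq_mul.
rewrite big_seq_cond rpred_sum // => r; rewrite andbT mem_index_iota ltnS.
move=> /andP[_ le_r6]; rewrite rpred_sum // => t /and3P[/and3P[_ _ /eqP sum_t] _ _].
by rewrite rpredZ ?monomial_sym_homog // size_map size_tuple.
Qed.

Section Coefficients.

Variables (k : nat) (m : 'X_{1..6}) (e : seq nat).
Hypothesis k_gt0 : (0 < k)%N.
Hypothesis part_e : is_partition (6 * k) e.
Hypothesis size_e : (size e <= 6)%N.
Hypothesis perm_m : perm_eq m (e ++ nseq (6 - size e) 0%N).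

Lemma mcoeff_monomial_sym_partition (F : fieldType) e' :
  is_partition (6 * k) e' -> (size e' <= 6)%N ->
  (monomial_sym F 6 e')@_m = (e' == e)%:R.
Proof.
move=> part_e' size_e'; rewrite mcoeff_monomial_sym // (permPl perm_m).
congr (nat_of_bool _)%:R; apply/idP/eqP => [|->//].
by move/(perm_padded part_e part_e').
Qed.

Lemma mcoeff_long_partitions (F : fieldType) :
  (\sum_(3 <= r < 7)
    \sum_(t : r.-tuple 'I_(6 * k).+1 |
            let e' := map val t in
            [&& is_partition (6 * k) e', congruent_parts e'
              & (r < 6)%N ==> all (fun x => 3 %| x)%N e'])
      (multinomial_coef (map val t))%:R *: monomial_sym F 6 (map val t))@_m =
  (multinomial_coef e * [&& 2 < size e, congruent_parts e
    & (size e < 6) ==> all (fun x => 3 %| x) e])%N%:R.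
Proof.
(* The conditions are moved from the tuple to [e], so that the only nonzero term is visible: r =
   [size e], with the tuple that lists [e]. *)
pose c r (t : r.-tuple 'I_(6 * k).+1) : F := (multinomial_coef e *
  ((map val t == e) && (congruent_parts e &&
    ((r < 6) ==> all (fun x => 3 %| x) e))))%N%:R.
rewrite raddf_sum (eq_big_seq (fun r => \sum_t c r t)); last first.
  move=> r; rewrite mem_index_iota ltnS => /andP[_ le_r6].
  rewrite raddf_sum /= big_mkcond; apply: eq_bigr => t _; rewrite /c.
  case: (boolP (is_partition _ _)) => [part_t|npart_t] /=.
    rewrite mcoeffZ mcoeff_monomial_sym_partition ?size_map ?size_tuple //.
    case: eqP => [->|_] /=; last by rewrite mulr0 muln0; case: ifP.
    by case: (_ && _); rewrite ?mulr1 ?muln1 ?muln0.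
  case: eqP => [te|_]; last by rewrite muln0.
  by rewrite te part_e in npart_t.
have c0 r (t : r.-tuple 'I_(6 * k).+1) : r != size e -> c r t = 0.
  move=> neq_re; rewrite /c; case: eqP => [te|_]; last by rewrite muln0.
  by rewrite -te size_map size_tuple eqxx in neq_re.
have [gt2|le2] := ltnP 2 (size e); last first.
  rewrite muln0 big_seq big1 // => r; rewrite mem_index_iota => /andP[le_3r _].
  by apply: big1 => t _; apply: c0; rewrite gtn_eqF // (leq_ltn_trans le2).
rewrite (bigD1_seq (size e)) ?iota_uniq ?mem_index_iota ?gt2 ?ltnS //=.
rewrite [X in _ + X]big1 ?addr0 => [|r neq_re]; last by apply: big1 => t _; apply: c0.
have [t te] : exists t : (size e).-tuple 'I_(6 * k).+1, map val t = e.
  have size_t : size (map (@inord (6 * k)) e) == size e by rewrite size_map.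
  exists (Tuple size_t); rewrite /= -map_comp map_id_in // => x x_e /=.
  rewrite inordK // ltnS; case/and3P: part_e => _ _ /eqP <-.
  by rewrite sumnE (big_rem x) //= leq_addr.
rewrite (bigD1 t) //= big1 => [|t' neq_t]; last first.
  rewrite /c; case: eqP => [te'|_]; last by rewrite muln0.
  by case/eqP: neq_t; apply/val_inj/(inj_map val_inj); rewrite te.
by rewrite addr0 /c te eqxx.
Qed.

End Coefficients.

Lemma support_values (m : seq nat) : size m = 6 ->
  [seq nth 0%N m l | l <- support m] = [seq x <- m | x != 0%N].
Proof.
move=> size_m; rewrite -[in RHS](mkseq_nth 0%N m) size_m /mkseq filter_map.
by [].
Qed.

(** A padding zero forces the common residue to be 0. This is the origin of the condition on
    partitions with fewer than six parts: congruence of all six exponents is the single underlying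
    condition. *)
Lemma congruent_parts_pad e j : congruent_parts (e ++ nseq j 0%N) =
  congruent_parts e && ((0 < j) ==> all (fun x => 3 %| x) e)%N.
Proof.
apply/allrelP/andP => [congr_e|[/allrelP congr_e dvd_e] x y].
  split.
    apply/allrelP => x y x_e y_e.
    by apply: congr_e; rewrite mem_cat ?x_e ?y_e.
  apply/implyP => j_gt0; apply/allP => x x_e; rewrite /dvdn -(mod0n 3).
  by apply: congr_e; rewrite mem_cat ?x_e // mem_nseq j_gt0 orbT.
have [->|j_gt0] := posnP j; first by rewrite cats0; apply: congr_e.
have mod_e z : z \in e ++ nseq j 0%N -> (z %% 3 = 0)%N.
  rewrite mem_cat => /orP[z_e|/nseqP[-> //]].
  by apply/eqP; apply: (allP (implyP dvd_e j_gt0)).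
by move=> /mod_e x0 /mod_e y0; rewrite x0 y0.
Qed.

Theorem f6_power_sum (F : numClosedFieldType) (w : F) k :
  w ^+ 2 + w + 1 = 0 -> (0 < k)%N ->
  f6_of F k = 81%:R^-1 *: power_sum w (6 * k).
Proof.
move=> w_root k_gt0; apply/mpolyP => m; rewrite mcoeffZ.
have [deg_m|neq_m] := eqVneq (mdeg m) (6 * k)%N; last first.
  rewrite (dhomog_nemf_coeff (f6_of_homog F k) neq_m).
  by rewrite (dhomog_nemf_coeff (power_sum_homog w _) neq_m) mulr0.
have sum_m : sumn m = (6 * k)%N by rewrite -mdeg_sumn.
have size_m : size m = 6 by rewrite size_tuple.
have [e []] := padded_partition size_m; rewrite sum_m => part_e size_e perm_m.
have part_perm : perm_eq [seq nth 0%N m l | l <- support m] e.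
  rewrite support_values // (permPl (perm_filter _ perm_m)) filter_cat.
  have [_ e0 _] := and3P part_e.
  rewrite [X in _ ++ X](_ : _ = [::]); last first.
    by apply/eqP; rewrite -size_eq0 size_filter count_nseq.
  rewrite cats0 (_ : filter _ e = e) //; apply/all_filterP/allP => x x_e.
  by apply: contraNneq e0 => <-.
have [/and3P[sort_e e_pos /eqP sum_e]] := part_e.
have mono_e e' := mcoeff_monomial_sym_partition part_e perm_m F (e' := e').
rewrite mcoeff_power_sum // (perm_multinomial_coef perm_m) multinomial_coef_pad.
have -> : congruent_parts m = congruent_parts (e ++ nseq (6 - size e) 0%N).
  by rewrite /congruent_parts (eq_allrel_meml _ _ (perm_mem perm_m))
    (eq_allrel_memr _ _ (perm_mem perm_m)).
have nz_supp : support m != [::].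
  apply/eqP => supp0; move: part_perm; rewrite supp0 => /perm_size/esym/size0nil e0.
  by move: sum_e; rewrite e0 /=; lia.
rewrite (sum_support F size_m sum_m nz_supp).
rewrite /f6_of !mcoeffD (mcoeff_long_partitions part_e size_e perm_m).
rewrite mcoeffZ mono_e //; last first.
  by rewrite /is_partition /= inE addn0 eqxx andbT eq_sym muln_eq0 -!lt0n.
rewrite raddf_sum (eq_big_seq (fun s => ('C(6 * k, 3 * s)%:R *
    (1 + (-1) ^+ (k + s) * 27 ^+ k.-1)) *
    ([:: 6 * k - 3 * s; 3 * s]%N == e)%:R)); last first.
  move=> s; rewrite mem_index_iota ltnS => /andP[s_gt0 le_sk].
  rewrite /= mcoeffZ mono_e //; rewrite /is_partition /= !inE; apply/and3P; split; lia.
(* The weight of a pair in f_6k; positivity of [k] allows one factor 27 to be split off. *)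
have F27 : 81%:R^-1 * (3%:R * (- 27%:R) ^+ k) = (-1) ^+ k * 27%:R ^+ k.-1 :> F.
  by rewrite -[k]prednK // exprS -mulN1r exprMn exprS /=; field.
have E81 n : 81%:R^-1 * (81 * n)%:R = n%:R :> F.
  by rewrite natrM mulrA mulVf ?mul1r // pnatr_eq0.
set V := match _ with | [::] => _ | _ => _ end.
(* The support lists exponents by index, the partition by size; for two exponents the orders may
   differ, and [pair_sign_sym] makes this harmless. *)
have VE : V = match e with
    | [:: x] => 5%:R | [:: x; y] => pair_sign F y | _ => 0 end.
  rewrite /V; move: part_perm sum_e; clear; case: [seq _ | _ <- _] => [|x [|y [|z s]]].
  - by case: e => // x e /perm_size.
  - by case: e => [|x' [|y' e]] // /perm_size.
  - case: e => [|x' [|y' [|z' e]]]; try by move=> /perm_size.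
    move=> /perm_mem xy /=; rewrite addn0 => sum_e.
    have : y \in [:: x'; y'] by rewrite -xy !inE eqxx orbT.
    by rewrite !inE => /orP[] /eqP -> //; apply: pair_sign_sym sum_e.
  - by case: e => [|x' [|y' [|z' e]]] // /perm_size.
rewrite VE congruent_parts_pad subn_gt0 {V VE}.
rewrite [RHS]mulrCA [_^-1 * (_ + _)]mulrDr E81 [_^-1 * (_ * _)]mulrA F27.
move: part_e sum_e; clear -k_gt0; case: e => [|x [|y [|z e]]] part_e sum_e.
- by move: sum_e => /=; lia.
- have -> : x = (6 * k)%N by rewrite -sum_e /= addn0.
  have -> : multinomial_coef [:: 6 * k]%N = 1%N.
    by rewrite /multinomial_coef big_seq1 /= addn0 divnn fact_gt0.
  rewrite eqxx big1 ?addr0 => [|s _]; last by rewrite eqseq_cons andbF mulr0.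
  rewrite /congruent_parts /allrel /= -(mulnA 3 2 k) dvdn_mulr // eqxx.
  by rewrite mulr1 mul1r addrC.
- have {}sum_e : (x + y = 6 * k)%N by rewrite -sum_e /= addn0.
  have {}part_e : (0 < y <= x)%N.
    by move: part_e => /and3P[/= + + _]; rewrite !inE; lia.
  (* With the padding zeros both parts must be divisible by 3, and x + y = 6k reduces this to y. *)
  have -> : (congruent_parts [:: x; y] && ((size [:: x; y] < 6) ==>
      all (fun x => 3 %| x) [:: x; y]))%N = (3 %| y)%N.
    by rewrite /congruent_parts /allrel /= !andbT; lia.
  rewrite multinomial_coef2 sum_e eqseq_cons andbF mulr0 add0r muln0 addr0.
  have [/dvdnP[s yE]|ndvd_y] := boolP (3 %| y)%N; last first.
    rewrite /pair_sign (negPf ndvd_y) mul0r mulr0 addr0 mulr0 big1 // => s _.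
    rewrite (_ : (_ == _) = false) ?mulr0 //; apply/eqP => -[_ yE].
    by rewrite -yE dvdn_mulr in ndvd_y.
  (* As y is the smaller part, y <= 3k, so s = y / 3 lies between 1 and k. *)
  have s_in : s \in index_iota 1 k.+1 by rewrite mem_index_iota; lia.
  rewrite (bigD1_seq s) ?iota_uniq //= big1 ?addr0 => [|s' neq_s]; last first.
    rewrite (_ : (_ == _) = false) ?mulr0 //; apply/eqP => -[_ yE'].
    by case/eqP: neq_s; lia.
  have -> : ([:: 6 * k - 3 * s; 3 * s]%N == [:: x; y]) = true.
    by apply/eqP; congr [:: _; _]; lia.
  rewrite mulr1 yE [(s * 3)%N]mulnC; congr (_ * _).
  rewrite /pair_sign dvdn_mulr // mul1r exprD exprM.
  rewrite (_ : (-1) ^+ 3 = -1 :> F); last by ring.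
  by ring.
(* With three or more parts no pair of variables contains the support, so only the words
   contribute. *)
- rewrite eqseq_cons andbF !mulr0 add0r big1 ?add0r => [|s _].
    by rewrite -natrM.
  by rewrite !eqseq_cons !andbF mulr0.
Qed.

(** * The group G34 *)

Section Generators.

Variables (F : numClosedFieldType) (w : F).
Hypothesis w_root : w ^+ 2 + w + 1 = 0.
Local Notation vec := (root_vec w).

Lemma pair_vec (i j : 'I_6) c : i != j -> (c < 3)%N ->
  vec (pair_root i j c) = eis_val w theta *: (delta_mx 0 i - w ^+ c *: delta_mx 0 j).
Proof.
move=> neq_ij c_lt3; apply/rowP => l; rewrite pair_entry // !mxE eqxx /=.
have [->|_] := eqVneq l i; first by rewrite (negPf neq_ij) mulr0 subr0 mulr1.
by case: eqP => _; rewrite ?mulr1 ?mulr0 sub0r mulrN ?mulr0 ?oppr0.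
Qed.

Lemma theta_neq0 : eis_val w theta != 0.
Proof. by rewrite eis_val_eq0. Qed.

Lemma reflection_pair (i j : 'I_6) : i != j ->
  mirror_reflection (vec (pair_root i j 0)) =
  mirror_reflection (delta_mx 0 i - delta_mx 0 j).
Proof. by move=> neq_ij; rewrite pair_vec // scale1r (reflectionZ _ theta_neq0). Qed.

Lemma reflection_pair_omega : mirror_reflection (vec (pair_root 0 1 1)) =
  mirror_reflection (delta_mx 0 (inord 0) - w *: delta_mx 0 (inord 1)).
Proof.
have := @pair_vec (inord 0) (inord 1) 1; rewrite !inordK // => -> //.
  by rewrite (reflectionZ _ theta_neq0).
by rewrite -val_eqE /= !inordK.
Qed.

Lemma vec_ones : vec (word_root (nseq 6 0%N)) = const_mx 1.
Proof.
apply/rowP => l; rewrite !mxE (nth_map 0%N) ?size_nseq //.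
by rewrite nth_nseq ltn_ord eis_val1.
Qed.

Lemma generator_pair (i j : 'I_6) : i != j ->
  exists2 a, a \in generators &
    mirror_reflection (delta_mx 0 i - delta_mx 0 j) = mirror_reflection (vec a).
Proof.
wlog lt_ij : i j / (i < j)%N => [ltE neq_ij|neq_ij].
  have := neq_ij; rewrite -val_eqE neq_ltn => /orP[lt_ij|lt_ji]; first exact: ltE.
  have [|a a_gen aE] := ltE j i lt_ji; first by rewrite eq_sym.
  exists a => //; rewrite -aE.
  have -> : delta_mx 0 i - delta_mx 0 j =
      (-1) *: (delta_mx 0 j - delta_mx 0 i) :> 'rV[F]_6.
    by rewrite scaleN1r opprB.
  by rewrite reflectionZ // oppr_eq0 oner_eq0.
exists (pair_root i j 0); last by rewrite reflection_pair.
rewrite mem_cat; apply/orP; left; apply/mapP; exists (i : nat, j : nat) => //.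
by rewrite mem_index_pairs lt_ij ltn_ord.
Qed.

Lemma generatorsP a : a \in generators ->
  [\/ exists i j : 'I_6, i != j /\ mirror_reflection (vec a) =
        mirror_reflection (delta_mx 0 i - delta_mx 0 j),
      mirror_reflection (vec a) =
        mirror_reflection (delta_mx 0 (inord 0) - w *: delta_mx 0 (inord 1)) |
      mirror_reflection (vec a) = mirror_reflection (const_mx 1)].
Proof.
rewrite mem_cat => /orP[/mapP[[i j]]|].
  rewrite mem_index_pairs => /andP[lt_ij j_lt6] ->.
  have neq_ij : Ordinal (ltn_trans lt_ij j_lt6) != Ordinal j_lt6.
    by rewrite -val_eqE /= ltn_eqF.
  apply: Or31; exists (Ordinal (ltn_trans lt_ij j_lt6)), (Ordinal j_lt6).
  by split=> //; rewrite -(reflection_pair neq_ij).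
rewrite !inE => /orP[] /eqP ->; first by apply: Or32; apply: reflection_pair_omega.
by apply: Or33; rewrite vec_ones.
Qed.

End Generators.

Section Statement.

Variable R : realType.
Implicit Types (p : {mpoly R[i][6]}).

Lemma reflectionE (a : 'rV[R[i]]_6) : reflection a = mirror_reflection a.
Proof. by []. Qed.

Lemma f6E k : f6 R k = f6_of R[i] k.
Proof. by []. Qed.

(** The defining mirrors and the rows of [generators] differ by scalars and by the order of the two
    indices, which leaves the reflections unchanged; products and inverses preserve being fixed. *)
Lemma G34_invariantE p :
  G_invariant (@G34 R) p <-> G_invariant (mirror_group (omega R)) p.
Proof.
have root := omega_root R.
split=> [p_inv _ [a a_gen ->]|p_inv g].
  have inv b : G34_mirror b -> mpoly_act (mirror_reflection b) p = p.
    by move=> b_mirror; apply: p_inv; apply: generated_gen; exists b.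
  have [[i [j [neq_ij ->]]]|->|->] := generatorsP root a_gen; apply: inv.
  - exact: mirror_diff.
  - exact: mirror_omega.
  - exact: mirror_sum.
elim=> {g} [|g [b b_mirror ->]|g h _ pg _ ph|g _ pg].
- exact: mpoly_act1.
- rewrite reflectionE; case: b_mirror => [i j neq_ij||].
  + have [a a_gen ->] := generator_pair root neq_ij.
    by apply: p_inv; exists a.
  + rewrite -(reflection_pair_omega root); apply: p_inv.
    by exists (pair_root 0 1 1); rewrite // mem_cat !inE eqxx orbT.
  + rewrite -(vec_ones (omega R)); apply: p_inv.
    by exists (word_root (nseq 6 0%N)); rewrite // mem_cat !inE eqxx !orbT.
- by rewrite -mpoly_actM pg ph.
- exact: mpoly_act_invmx.
Qed.

Lemma f6_tuple : [tuple f6 R 1; f6 R 2; f6 R 3; f6 R 4; f6 R 5; f6 R 7] =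
  [tuple invariants (omega R) i | i < 6].
Proof.
apply: eq_from_tnth => i; rewrite tnth_mktuple /invariants.
have f6_inv k : (0 < k)%N -> f6 R k = 81%:R^-1 *: power_sum (omega R) (6 * k).
  by move=> k_gt0; rewrite f6E; apply: f6_power_sum (omega_root R) k_gt0.
by rewrite (tnth_nth 0); case: i => [[|[|[|[|[|[|]]]]]] //= _]; rewrite -f6_inv.
Qed.

End Statement.

Theorem theorem5p1 (R : realType) :
  polynomial_algebra_on (G_invariant (@G34 R))
    [tuple f6 R 1; f6 R 2; f6 R 3; f6 R 4; f6 R 5; f6 R 7].
Proof.
have [gen free] := mirror_group_invariants (omega_root R).
rewrite f6_tuple; split=> // p; split=> [/G34_invariantE/gen //|].
by move/gen/G34_invariantE.
Qed.
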